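(* Let $K\subset\mathbb R^n$ be a full-dimensional compact convex body with barycenter $0$, $\operatorname{int}(K)\cap\mathbb Z^n=\{0\}$, and $\operatorname{vol}(K)=(n+1)^n/n!$. Then, for every $\varepsilon>0$ and all sufficiently large $k$, no nonzero real polynomial (in $n$ variables) of total degree at most $(n+1-\varepsilon)k$ vanishes at every point of $S_k$. Equivalently, \[ \liminf_{k\to\infty}\frac{\delta(S_k)}{k}\ge n+1. \]
   Context: For a positive integer $k$, $S_k=\mathbb Z^n\cap\operatorname{int}(kK)$. For a finite set $S\subset\mathbb R^n$, $\delta(S)$ denotes the least total degree of a nonzero real polynomial in $n$ variables vanishing at every point of $S$. The barycenter of $K$ is $\frac1{\operatorname{vol}(K)}\int_Ky\,dy$. *)

(* Defs.v *)
From HB Require Import structures.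
From mathcomp Require Import all_boot all_order all_algebra.
(* The notations of mpoly cannot be parsed next to those of mathcomp-analysis;
   [mpoly n R] is the type written {mpoly R[n]} in multinomials. *)
From mathcomp.multinomials Require Import -(notations) mpoly.
From mathcomp Require Import all_classical all_reals all_analysis.

Set Implicit Arguments.
Unset Strict Implicit.
Unset Printing Implicit Defensive.

Import Order.TTheory GRing.Theory Num.Theory.
Import numFieldNormedType.Exports.

Local Open Scope classical_set_scope.
Local Open Scope ring_scope.

Section borel_rV.
Context (R : realType) (n : nat).

(* The sigma-algebra generated by the coordinates, i.e. the Borel sets of R^n. *)
Let coord (i : 'I_n) (x : 'rV[R]_n) : measurableTypeR R := x 0 i.

Let borel0 : g_sigma_preimage coord set0.
Proof. exact: sigma_algebra0. Qed.

Let borelC A : g_sigma_preimage coord A -> g_sigma_preimage coord (~` A).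
Proof. exact: sigma_algebraC. Qed.

Let borel_bigcup (F : (set 'rV[R]_n)^nat) :
  (forall i, g_sigma_preimage coord (F i)) ->
  g_sigma_preimage coord (\bigcup_i F i).
Proof. exact: sigma_algebra_bigcup. Qed.

HB.instance Definition _ := @isMeasurable.Build default_measure_display
  'rV[R]_n (g_sigma_preimage coord) borel0 borelC borel_bigcup.

Lemma measurable_coord (i : 'I_n) :
  measurable_fun [set: 'rV[R]_n] (fun x : 'rV[R]_n => x 0 i : measurableTypeR R).
Proof.
move=> _ Y mY; rewrite setTI; apply: sub_sigma_algebra => /=.
rewrite -bigcup_seq/=; exists i => /=; first by rewrite mem_index_enum.
by exists Y => //; rewrite setTI.
Qed.

Lemma measurable_fun_rV d (T : measurableType d) (f : T -> 'rV[R]_n) :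
  (forall i, measurable_fun setT (fun x => f x 0 i : measurableTypeR R)) ->
  measurable_fun setT f.
Proof.
move=> mf _ Y mY; rewrite setTI.
suff : g_sigma_preimage coord `<=` [set A | measurable (f @^-1` A)] by exact.
apply: smallest_sub.
  split => /=.
  - by rewrite preimage_set0.
  - by move=> A; rewrite setTD preimage_setC; exact: measurableC.
  - by move=> F mF; rewrite preimage_bigcup; exact: bigcup_measurable.
rewrite -bigcup_seq => A [i _] [B mB <-] /=.
by rewrite setTI -[X in measurable X]setTI; exact: (mf i measurableT B mB).
Qed.

End borel_rV.

Section lebesgue_rV.
Context (R : realType).

Definition rV_cons n (p : measurableTypeR R * 'rV[R]_n) : 'rV[R]_n.+1 :=
  \row_i oapp (p.2 0) p.1 (unlift ord0 i).

Definition rV_uncons n (x : 'rV[R]_n.+1) : measurableTypeR R * 'rV[R]_n :=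
  (x 0 ord0, \row_i x 0 (lift ord0 i)).

Lemma rV_consK n : cancel (@rV_cons n) (@rV_uncons n).
Proof.
move=> [a x]; rewrite /rV_uncons /rV_cons mxE unlift_none; congr pair.
by apply/rowP => i; rewrite !mxE liftK.
Qed.

Lemma measurable_rV_cons n : measurable_fun setT (@rV_cons n).
Proof.
apply: measurable_fun_rV => i; rewrite /rV_cons.
case: (unliftP ord0 i) => [j|] ->.
  under eq_fun do rewrite mxE liftK /=.
  by apply: (measurableT_comp (measurable_coord j)).
under eq_fun do rewrite mxE unlift_none /=.
exact: measurable_fst.
Qed.

Lemma measurable_rV_uncons n : measurable_fun setT (@rV_uncons n).
Proof.
apply: measurable_fun_pair; first exact: measurable_coord.
apply: measurable_fun_rV => i.
under eq_fun do rewrite mxE.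
exact: measurable_coord.
Qed.

Section step.
Context (n : nat) (mu : {sigma_finite_measure set 'rV[R]_n -> \bar R}).

Definition lebesgue_step : set 'rV[R]_n.+1 -> \bar R :=
  pushforward (@lebesgue_measure R \x mu)%E (@rV_cons n).

Let step0 : lebesgue_step set0 = 0%E.
Proof. by rewrite /lebesgue_step /pushforward preimage_set0 measure0. Qed.

Let step_ge0 A : (0 <= lebesgue_step A)%E.
Proof. by rewrite /lebesgue_step /pushforward; exact: measure_ge0. Qed.

Let step_sigma_additive : semi_sigma_additive lebesgue_step.
Proof.
move=> F mF tF mUF; rewrite /lebesgue_step /pushforward preimage_bigcup.
have mc (A : set 'rV[R]_n.+1) : measurable A -> measurable (@rV_cons n @^-1` A).
  by move=> mA; rewrite -[X in measurable X]setTI; exact: measurable_rV_cons.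
apply: measure_semi_sigma_additive.
- by move=> i; exact: mc.
- apply/trivIsetP => /= i j _ _ ij; rewrite -preimage_setI.
  by move/trivIsetP : tF => /(_ _ _ _ _ ij) ->//; rewrite preimage_set0.
- by rewrite -preimage_bigcup; exact: mc.
Qed.

HB.instance Definition _ :=
  isMeasure.Build _ _ _ lebesgue_step step0 step_ge0 step_sigma_additive.

Let step_sigma_finite : sigma_finite setT lebesgue_step.
Proof.
have /sigma_finiteP[F [TF ndF Foo]] := sigma_finiteT (@lebesgue_measure R).
have /sigma_finiteP[G [TG ndG Goo]] := sigma_finiteT mu.
exists (fun k => @rV_uncons n @^-1` (F k `*` G k)).
  rewrite -preimage_bigcup (_ : \bigcup_k _ = setT) ?preimage_setT//.
  apply/seteqP; split => // -[a x] _.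
  have [k _ Fka] : (\bigcup_k F k) a by rewrite -TF.
  have [l _ Glx] : (\bigcup_k G k) x by rewrite -TG.
  exists (maxn k l) => //; split => /=.
  - by move: a Fka; exact/subsetPset/ndF/leq_maxl.
  - by move: x Glx; exact/subsetPset/ndG/leq_maxr.
move=> k; have [mFk Fk] := Foo k; have [mGk Gk] := Goo k; split.
  rewrite -[X in measurable X]setTI; apply: measurable_rV_uncons => //.
  exact: measurableX.
rewrite /lebesgue_step /pushforward -comp_preimage.
rewrite (_ : _ \o _ = id) ?preimage_id; last exact/funext/rV_consK.
by rewrite product_measure1E// lte_mul_pinfty// ge0_fin_numE.
Qed.

HB.instance Definition _ :=
  Measure_isSigmaFinite.Build _ _ _ lebesgue_step step_sigma_finite.

End step.

Fixpoint lebesgue_rV n : {sigma_finite_measure set 'rV[R]_n -> \bar R} :=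
  if n is m.+1 then lebesgue_step (lebesgue_rV m) else dirac (0 : 'rV[R]_0).

Lemma lebesgue_rV_box n (A : 'I_n -> set (measurableTypeR R)) :
  (forall i, measurable (A i)) ->
  lebesgue_rV n [set x : 'rV[R]_n | forall i, A i (x 0 i)] =
  (\prod_(i < n) lebesgue_measure (A i))%E.
Proof.
elim: n A => [|n IH] A mA.
  by rewrite big_ord0 /= diracE mem_set // => -[].
rewrite big_ord_recl.
have boxE : @rV_cons n @^-1` [set x : 'rV[R]_n.+1 | forall i, A i (x 0 i)] =
    A ord0 `*` [set x : 'rV[R]_n | forall i, A (lift ord0 i) (x 0 i)].
  apply/seteqP; split => -[a x] /=.
    move=> Aax; split.
      by have := Aax ord0; rewrite mxE unlift_none.
    by move=> i; have := Aax (lift ord0 i); rewrite mxE liftK.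
  move=> [Aa Ax] i; rewrite mxE.
  by case: (unliftP ord0 i) => [j|] ->.
rewrite /= /lebesgue_step /pushforward boxE product_measure1E //; last first.
  rewrite (_ : [set _ | _] = \bigcap_(i in [set: 'I_n])
      ((fun x : 'rV[R]_n => x 0 i : measurableTypeR R) @^-1` A (lift ord0 i))).
    apply: fin_bigcap_measurable => // i _.
    by rewrite -[X in measurable X]setTI; exact: measurable_coord.
  by apply/seteqP; split => x /= Ax i; [move=> _|]; exact: Ax.
by congr (_ * _)%E; exact: IH.
Qed.

End lebesgue_rV.

Section convex_bodies.
Context (R : realType) (n : nat).
Implicit Types (K S : set 'rV[R]_n) (p : mpoly n R).

Definition convex_body K := [/\ compact K, convex_set K & K° !=set0].

Definition barycenter K : 'rV[R]_n :=
  \row_i ((fine (lebesgue_rV R n K))^-1 *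
          \int[lebesgue_rV R n]_(y in K) (y 0 i)).

Definition integer_points : set 'rV[R]_n :=
  [set x | forall i, x 0 i \is a Num.int].

Definition dilate (k : nat) K : set 'rV[R]_n := [set k%:R *: x | x in K].

Definition dilate_points K (k : nat) : set 'rV[R]_n :=
  integer_points `&` (dilate k K)°.

Definition total_degree p : nat := (\max_(m <- msupp p) mdeg m)%N.

Definition vanishes_on p S := forall x, S x -> meval (x 0) p = 0.

(* The infimum of a set of natural numbers is attained unless the set is empty
   (see [delta_attained]), in which case it is +oo. *)
Definition delta S : \bar R :=
  ereal_inf [set (total_degree p)%:R%:E | p in
               [set p : mpoly n R | p != 0 /\ vanishes_on p S]].

Lemma delta_attained S :
  (exists2 p, p != 0 & vanishes_on p S) ->
  exists p, [/\ p != 0, vanishes_on p S & delta S = (total_degree p)%:R%:E].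
Proof.
move=> [q q0 qS].
pose P d := `[< exists p, [/\ p != 0, vanishes_on p S & total_degree p = d] >].
have exP : exists d, P d by exists (total_degree q); apply/asboolP; exists q.
have [d /asboolP[p [p0 pS pd]] dmin] := ex_minnP exP.
exists p; split => //; apply/eqP; rewrite eq_le; apply/andP; split.
  by apply: ereal_inf_lbound; exists p.
apply: le_ereal_inf_tmp => _ [r [r0 rS] <-]; rewrite lee_fin ler_nat pd.
by apply: dmin; apply/asboolP; exists r.
Qed.

End convex_bodies.

Arguments integer_points : clear implicits.

(* Main.v *)
From HB Require Import structures.
Require Import Defs.
From mathcomp Require Import all_boot all_order all_algebra finfield.
From mathcomp.multinomials Require Import -(notations) mpoly.
From mathcomp Require Import all_classical all_reals all_analysis.
From mathcomp Require Import measurable_realfun zify ring lra.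

Import Order.TTheory GRing.Theory Num.Theory.
Import numFieldNormedType.Exports.

Local Open Scope classical_set_scope.
Local Open Scope ring_scope.

Set Implicit Arguments.
Unset Strict Implicit.
Unset Printing Implicit Defensive.

(** Let [S] be the set of lattice points in the interior of [kK], [N] its
    cardinal and [s] the sum of its points. A function [c] on [S] is encoded as
    the Laurent polynomial [sum_b c_b X^b]; it annihilates every polynomial of
    degree [< r] exactly when this Laurent polynomial vanishes to order [r] at
    the point [1 = (1, ..., 1)] of the torus. So, if [h_l] is the rank of the
    evaluation on [S] of polynomials of degree [<= l], then there are [N - h_l]
    independent Laurent polynomials with exponents in [S] that vanish to order
    [l + 1] at 1. Order the monomials. Since a space of Laurent polynomials has
    at least as many leading exponents as its dimension, every [a] in [S] is the
    leading exponent of some [f_a] with integer coefficients, exponents in [S],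
    and vanishing order [mu_a] at 1, where [sum_a mu_a >= sum_l (N - h_l)]
    ([vanishing_basis]).

    The heart of the proof is an upper bound for [sum_a mu_a]. The product [F]
    of all [f_a^j] has leading exponent [j s] and vanishes to order
    [j sum_a mu_a] at 1. Let [p] be a prime. If that order exceeds [n (p - 1)],
    then the coefficients of [F] annihilate the polynomial
    [prod_i (1 - (m_i - j s_i)^(p-1))] in the exponent [m], which modulo [p] is
    the indicator of the class of [j s]. An exponent [m] of [F] in this class
    satisfies [m - j s = p z] with [z] integral. If moreover the exponents of
    [F], translated by [- j s], lie in the interior of [pK], then [z] is a
    lattice point interior to [K], so [z = 0] and [m = j s]. Hence [p] divides
    the leading coefficient of [F], which is impossible for large [p]
    ([dvdz_mcoeff_isolated], [sum_vanishing_le]). The barycenter condition says that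
    [s = o(k N)], so the assumption on the exponents holds for [j] up to
    [p / (k N (1 + o(1)))]; letting [p] grow gives
    [sum_l (N - h_l) <= n k N (1 + o(1))].

    Suppose now that a nonzero polynomial of degree [d] vanishes on [S]. Its
    multiples show that [h_l <= C(l+n, n) - C(l-d+n, n)] ([rank_evalmx]).
    Summing over [l < D], where [D = (n + 1) k], yields
    [D N + C(D-d+n, n+1) <= n k N (1 + o(1)) + C(D+n, n+1)]
    ([evaluation_inequality], [lattice_inequality]). As [N] is equivalent to
    [vol(K) k^n = (n+1)^n k^n / n!], the terms of order [k^(n+1)] cancel except
    for [(D - d)^(n+1) / (n+1)!], and therefore [D - d = o(k)].

    The two asymptotic facts, [N ~ vol(K) k^n] and [s = o(k N)], are limits of
    Riemann sums ([riemann_sum_cvg]): these are integrals of step functions, and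
    dominated convergence applies because the boundary of a convex body is a
    null set ([interior_full_measure]). *)

(** * Vanishing order at 1 and moments of the exponents *)

Lemma mnm_subK1 n (m : multinom n) i :
  m i != 0%N -> mnm_add (mnm_sub m (mnm1 i)) (mnm1 i) = m.
Proof.
move=> mi; apply/mnmP => j; rewrite mnmDE mnmBE mnm1E.
by have [<-|_] := eqVneq i j; rewrite ?subn0 ?addn0 ?subnK// lt0n.
Qed.

Section vanishing_order.
Context (R : comNzRingType) (n : nat).
Implicit Types (f h : mpoly n R) (g : multinom n -> R) (m e : multinom n).

(** The linear form [X^m |-> g m]. When [g] is a polynomial, this is a
    differential operator in the [x_i d/dx_i], followed by evaluation at 1. *)
Definition pairing g f := \sum_(m <- msupp f) mcoeff m f * g m.

Lemma pairing_widen g f (s : seq (multinom n)) :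
  uniq s -> {subset msupp f <= s} ->
  pairing g f = \sum_(m <- s) mcoeff m f * g m.
Proof.
move=> us fs; rewrite [RHS](bigID (mem (msupp f)))/=.
rewrite [X in _ + X]big1 ?addr0; last first.
  by move=> m mf; rewrite memN_msupp_eq0 ?mul0r.
rewrite -big_filter; apply: perm_big; apply: uniq_perm.
- exact: msupp_uniq.
- exact: filter_uniq.
- move=> m; rewrite mem_filter; apply/idP/andP => [mf|[]//].
  by split=> //; exact: fs.
Qed.

Lemma pairing_is_linear g : linear_for *%R (pairing g).
Proof.
move=> c f h.
pose s := undup (msupp f ++ msupp h ++ msupp (c *: f + h)).
have us : uniq s by exact: undup_uniq.
have sE m : m \in s = [|| m \in msupp f, m \in msupp h | m \in msupp (c *: f + h)].
  by rewrite mem_undup !mem_cat.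
rewrite !(@pairing_widen g _ s) //; try by move=> m mf; rewrite sE mf ?orbT.
rewrite mulr_sumr -big_split/=; apply: eq_bigr => m _.
by rewrite mcoeffD mcoeffZ mulrDl mulrA.
Qed.

HB.instance Definition _ g := GRing.isLinear.Build R (mpoly n R) R *%R
  (pairing g) (@pairing_is_linear g).

Lemma pairingX g m : pairing g (@mpolyX n R m) = g m.
Proof. by rewrite /pairing msuppX big_seq1 mcoeffX eqxx mul1r. Qed.

Lemma pairing1M f h : pairing (fun=> 1) (f * h) = pairing (fun=> 1) f * pairing (fun=> 1) h.
Proof.
have E k : pairing (fun=> 1) k = meval (fun=> 1) k.
  rewrite mevalE; apply: eq_bigr => m _; congr (_ * _).
  by rewrite big1// => i _; rewrite expr1n.
by rewrite !E mevalM.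
Qed.

(** The derivation [x_i d/dx_i], which multiplies [X^m] by [m_i]. It turns
    moments into values at 1, to which the Leibniz rule applies. *)
Definition euler (i : 'I_n) f := @mpolyX n R (mnm1 i) * mderiv i f.

Lemma eulerM i f h : euler i (f * h) = euler i f * h + f * euler i h.
Proof. by rewrite /euler mderivM mulrDr (mulrA _ _ h) (mulrCA _ f). Qed.

Lemma pairing_euler g i f :
  pairing g (euler i f) = pairing (fun m => (m i)%:R * g m) f.
Proof.
rewrite /euler [in LHS](mpolyE f) raddf_sum mulr_sumr raddf_sum /=.
apply: eq_bigr => m _.
rewrite mderivZ mderivX scalerA -scalerAr linearZ/= -mpolyXD.
have [->|mi] := eqVneq (m i) 0%N; first by rewrite mulr0 !mul0r mulr0.
by rewrite addmC mnm_subK1// pairingX mulrA.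
Qed.

Definition mpow e m : R := \prod_i (m i)%:R ^+ e i.

(** Vanishing to order [r] at [(1, ..., 1)]: the moments of degree [< r] are the
    values at 1 of the compositions of fewer than [r] Euler operators, and at a
    point with invertible coordinates these span the same functionals as the
    partial derivatives of order [< r]. *)
Definition vanishes1 r f := forall e, (mdeg e < r)%N -> pairing (mpow e) f = 0.

(** A monomial of positive degree is some [m_i] times a monomial of smaller
    degree, and weighting by [m_i] is applying an Euler operator. *)
Lemma vanishes1S r f :
  vanishes1 r.+1 f <->
  pairing (fun=> 1) f = 0 /\ forall i, vanishes1 r (euler i f).
Proof.
have m0 : mpow (@mnm0 n) = fun=> 1.
  by apply/funext => m; rewrite /mpow big1// => i _; rewrite mnm0E expr0.
have mS e i : mpow (mnm_add e (mnm1 i)) = fun m => (m i)%:R * mpow e m.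
  apply/funext => m; rewrite /mpow (bigD1 i)//= [in RHS](bigD1 i)//=.
  rewrite mulrA -exprS; congr (_ * _).
    by rewrite mnmDE mnm1E eqxx addn1.
  apply: eq_bigr => j ji; rewrite mnmDE mnm1E eq_sym (negbTE ji) addn0//.
split=> [vf|[f0 vf] e].
  split; first by rewrite -m0; apply: vf; rewrite mdeg0.
  by move=> i e er; rewrite pairing_euler -mS; apply: vf; rewrite mdegD mdeg1; lia.
have [->|] := eqVneq e (@mnm0 n); first by rewrite m0.
move=> e0 er.
have [i ei] : exists i, e i != 0%N.
  apply/existsP; rewrite -negb_forall; apply: contra e0 => /forallP e0.
  by apply/eqP/mnmP => i; rewrite mnm0E; apply/eqP.
rewrite (_ : e = mnm_add (mnm_sub e (mnm1 i)) (mnm1 i)); last first.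
  by rewrite mnm_subK1.
rewrite mS -pairing_euler; apply: vf.
have : mdeg e = (mdeg (mnm_sub e (mnm1 i)) + 1)%N.
  rewrite -(mdeg1 i) -mdegD mnm_subK1//.
lia.
Qed.

Lemma vanishes1_le r s f : (s <= r)%N -> vanishes1 r f -> vanishes1 s f.
Proof. by move=> sr vf e es; apply: vf; exact: leq_trans sr. Qed.

Lemma vanishes1D r f h : vanishes1 r f -> vanishes1 r h -> vanishes1 r (f + h).
Proof. by move=> vf vh e er; rewrite linearD/= vf// vh// addr0. Qed.

Lemma vanishes1_euler r f i : vanishes1 r f -> vanishes1 r.-1 (euler i f).
Proof. by case: r => [|r] //; move=> /vanishes1S[_]; apply. Qed.

(** Induction on [r + s]: the value at 1 is multiplicative, and the Leibniz rule
    lowers only one of the two orders at a time. *)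
Lemma vanishes1M r s f h :
  vanishes1 r f -> vanishes1 s h -> vanishes1 (r + s) (f * h).
Proof.
have [k] := ubnP (r + s)%N; elim: k r s f h => // k IH r s f h rsk vf vh.
case rsE : (r + s)%N rsk => [|l] lk; first by move=> e.
apply/vanishes1S; split.
  rewrite pairing1M; move: rsE vf vh.
  case: r => [|r]; last by move=> _ /vanishes1S[-> _]; rewrite mul0r.
  by case: s => [//|s] _ _ /vanishes1S[-> _]; rewrite mulr0.
move=> i; rewrite eulerM; apply: vanishes1D.
- have -> : l = (r.-1 + (l - r.-1))%N by lia.
  apply: IH; [lia|exact: vanishes1_euler|apply: vanishes1_le vh; lia].
- have -> : l = ((l - s.-1) + s.-1)%N by lia.
  apply: IH; [lia|apply: vanishes1_le vf; lia|exact: vanishes1_euler].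
Qed.

Lemma vanishes1X r f j : vanishes1 r f -> vanishes1 (j * r) (f ^+ j).
Proof.
move=> vf; elim: j => [|j IH]; first by move=> e.
by rewrite exprS mulSn; exact: vanishes1M.
Qed.

Lemma vanishes1_prod (I : Type) (s : seq I) (F : I -> mpoly n R) (r : I -> nat) :
  (forall i, vanishes1 (r i) (F i)) ->
  vanishes1 (\sum_(i <- s) r i) (\prod_(i <- s) F i).
Proof.
move=> vF; elim: s => [|i s IH]; first by rewrite big_nil => e.
by rewrite !big_cons; exact: vanishes1M.
Qed.

Lemma pairing_meval r f (P : mpoly n R) : vanishes1 r f -> (msize P <= r)%N ->
  pairing (fun m => meval (fun i => (m i)%:R) P) f = 0.
Proof.
move=> vf Pr; rewrite /pairing.
under eq_bigr do rewrite mevalE mulr_sumr.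
rewrite exchange_big/= big1_seq// => e /andP[_ eP].
transitivity (mcoeff e P * pairing (mpow e) f).
  by rewrite /pairing mulr_sumr; apply: eq_bigr => m _; rewrite mulrCA.
by rewrite vf ?mulr0//; apply: leq_trans Pr; exact: msize_mdeg_lt.
Qed.

End vanishing_order.

Lemma msizeX_le (R : idomainType) n (p : mpoly n R) d k :
  (msize p <= d.+1)%N -> (msize (p ^+ k) <= (k * d).+1)%N.
Proof.
move=> pd; have [->|p0] := eqVneq p 0.
  by rewrite expr0n; case: k => [|k] /=; rewrite ?msize1// msize0.
elim: k => [|k IH]; first by rewrite expr0 msize1.
rewrite exprS msizeM ?expf_neq0// mulSn.
by have := leq_add pd IH; rewrite addSn addnS; case: (_ + _)%N.
Qed.

Lemma msize_prod_le (R : idomainType) n (I : Type) (s : seq I)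
    (F : I -> mpoly n R) (d : I -> nat) :
  (forall i, msize (F i) <= (d i).+1)%N ->
  (msize (\prod_(i <- s) F i) <= (\sum_(i <- s) d i).+1)%N.
Proof.
move=> Fd; elim: s => [|i s IH]; first by rewrite !big_nil msize1.
rewrite !big_cons; have [->|F0] := eqVneq (F i) 0; first by rewrite mul0r msize0.
have [->|G0] := eqVneq (\prod_(j <- s) F j) 0; first by rewrite mulr0 msize0.
rewrite msizeM//=.
by have := leq_add (Fd i) IH; rewrite addSn addnS; case: (_ + _)%N.
Qed.

(** * Bounding vanishing orders by reduction modulo a prime *)

(** By Fermat's little theorem, [prod_i (1 - (m_i - t_i)^(p-1))] is modulo [p]
    the indicator of the class of [t]. Its degree is at most [n (p - 1)], so
    pairing [f] with it gives 0; modulo [p] the result is the coefficient of [f]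
    at [t], the only exponent of [f] in that class. *)
Lemma dvdz_mcoeff_isolated n (f : mpoly n int) (p : nat) (t : multinom n) :
  prime p -> vanishes1 (n * p.-1).+1 f ->
  {in msupp f, forall m : multinom n, (forall i, (m i = t i %[mod p])%N) -> m = t} ->
  (p%:Z %| mcoeff t f)%Z.
Proof.
move=> pp vf ft.
pose P : mpoly n int := \prod_i (1 - (@mpolyX n int (mnm1 i) - mpolyC n (t i)%:R) ^+ p.-1).
have sP : (msize P <= (n * p.-1).+1)%N.
  have -> : (n * p.-1 = \sum_(i < n) p.-1)%N by rewrite sum_nat_const card_ord.
  apply: msize_prod_le => i.
  apply: (leq_trans (mmeasureD_le _ _ _)); rewrite geq_max msize1/= mmeasureN -[X in (_ <= X.+1)%N]muln1.
  apply: msizeX_le; apply: (leq_trans (mmeasureD_le _ _ _)).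
  by rewrite msizeX mdeg1 mmeasureN geq_max mmeasureC; case: (_ == 0).
have := pairing_meval vf sP.
have pF : p \in [pchar 'F_p] by exact: pchar_Fp.
have p1 : (0 < p.-1)%N by have := prime_gt1 pp; lia.
move=> /(congr1 (fun z : int => z%:~R : 'F_p)).
rewrite /pairing rmorph0 rmorph_sum/=.
have key m : m \in msupp f -> (mcoeff m f * meval (fun i => (m i)%:R) P)%:~R =
    (if m == t then (mcoeff t f)%:~R else 0) :> 'F_p.
  move=> mf; rewrite rmorphM/= /P rmorph_prod/= rmorph_prod /=.
  have E i : (meval (fun i => (m i)%:R)
      (1 - (@mpolyX n int (mnm1 i) - mpolyC n (t i)%:R) ^+ p.-1))%:~R =
      ((m i)%:R == (t i)%:R :> 'F_p)%:R :> 'F_p.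
    rewrite mevalB meval1 rmorphXn/= mevalB mevalXU mevalC.
    rewrite rmorphB rmorphXn/= rmorphB/= !rmorph_nat rmorph1.
    have [->|mt] := eqVneq ((m i)%:R : 'F_p) (t i)%:R.
      by rewrite subrr expr0n; case: p.-1 p1 => //= ? _; rewrite subr0.
    have mt0 : ((m i)%:R - (t i)%:R : 'F_p) != 0 by rewrite subr_eq0.
    apply/eqP; rewrite subr_eq0 eq_sym; apply/eqP/(mulfI mt0).
    by rewrite -exprS prednK ?prime_gt0// -[X in _ ^+ X]card_Fp// expf_card mulr1.
  under eq_bigr do rewrite E.
  have [->|mt] := eqVneq m t.
    by rewrite big1 ?mulr1// => i _; rewrite eqxx.
  have [i mti] : exists i, (m i)%:R != (t i)%:R :> 'F_p.
    apply/existsP; rewrite -negb_forall; apply: contra mt => /forallP mt.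
    apply/eqP/ft => // i; have /eqP/(congr1 (@nat_of_ord _)) := mt i.
    by rewrite !(val_Fp_nat pp).
  by rewrite (bigD1 i)//= (negbTE mti) mul0r mulr0.
rewrite (eq_big_seq _ key) -big_mkcond/=.
have [tf|tf] := boolP (t \in msupp f); last by rewrite memN_msupp_eq0 // dvdz0.
rewrite -big_filter (_ : [seq m <- _ | m == t] = [:: t]); last first.
  by rewrite (@filter_pred1_uniq _ _ t) // msupp_uniq.
by rewrite big_seq1 => /eqP; rewrite -(dvdz_pcharf pF).
Qed.

(** The exponents of a product are sums of exponents of the factors; [C a m] is
    meant as a condition on sums [m] of [a] exponents. *)
Lemma msupp_prod_ind (R : comNzRingType) n (C : nat -> multinom n -> Prop) :
  C 0%N (@mnm0 n) ->
  (forall a b m m', C a m -> C b m' -> C (a + b)%N (mnm_add m m')) ->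
  forall (I : Type) (s : seq I) (f : I -> mpoly n R) (j : nat),
  (forall i, {in msupp (f i), forall m : multinom n, C 1%N m}) ->
  {in msupp (\prod_(i <- s) f i ^+ j), forall m : multinom n, C (size s * j)%N m}.
Proof.
move=> C0 CD I s f j fC.
have CM a b (g h : mpoly n R) : {in msupp g, forall m : multinom n, C a m} ->
    {in msupp h, forall m : multinom n, C b m} ->
    {in msupp (g * h), forall m : multinom n, C (a + b)%N m}.
  move=> gC hC m /msuppM_le /allpairsP[[m1 m2] /= [m1g m2h ->]].
  by apply: CD; [exact: gC|exact: hC].
have C1 : {in msupp (1 : mpoly n R), forall m : multinom n, C 0%N m}.
  by move=> m; rewrite msupp1 inE => /eqP ->.
elim: s => [|i s IH]; first by rewrite big_nil.
rewrite big_cons /= mulSn; apply: (CM) => //.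
elim: j {IH} => [|j IH]; first by rewrite expr0.
by rewrite exprS -add1n; exact: CM.
Qed.

Lemma prod_lead n N (f : 'I_N -> mpoly n int) (j : nat) :
  (forall i, f i != 0) ->
  mcoeff (mlead (\prod_i f i ^+ j)) (\prod_i f i ^+ j) =
  \prod_i mcoeff (mlead (f i)) (f i) ^+ j.
Proof.
move=> f0; rewrite mlead_prod; last by move=> i _ _; rewrite expf_neq0.
rewrite mleadc_prod; apply: eq_bigr => i _.
by rewrite mleadX// mleadcX.
Qed.

(** For a large prime [p], take [j] about [p / Q]. If the bound failed, the
    product of the [f_i^j] would vanish to order more than [n (p - 1)], and [p]
    would divide its leading coefficient, a product of powers of nonzero
    integers that do not depend on [p]. *)
Lemma sum_vanishing_le n N (f : 'I_N -> mpoly n int) (mu : 'I_N -> nat) (Q : nat) :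
  (forall i, f i != 0) -> (forall i, vanishes1 (mu i) (f i)) -> (0 < Q)%N ->
  (forall j p : nat, (j * Q <= p)%N -> (0 < p)%N -> let F := \prod_i f i ^+ j in
    {in msupp F, forall m : multinom n,
      (forall i, (m i = mlead F i %[mod p])%N) -> m = mlead F}) ->
  (\sum_i mu i <= n * Q)%N.
Proof.
move=> f0 vf Q0 sep; rewrite leqNgt; apply/negP => muQ.
have [p pB pp] := prime_above ((n * Q).+1 * Q + \sum_i `|mcoeff (mlead (f i)) (f i)|).
pose j := (p %/ Q)%N.
have jQ : (j * Q <= p)%N by exact: leq_divM.
have pj : (p < j.+1 * Q)%N by rewrite ltn_ceil.
(* [j (n Q + 1) >= n (j + 1) Q + 1 > n (p - 1)] as soon as [j > n Q], whence
   the lower bound imposed on [p]. *)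
have jn : (n * Q < j)%N.
  by rewrite /j leq_divRL //; lia.
pose F := \prod_i f i ^+ j.
have vF : vanishes1 (n * p.-1).+1 F.
  apply: (@vanishes1_le _ _ (\sum_i j * mu i)); last first.
    by apply: vanishes1_prod => i; exact: vanishes1X.
  rewrite -big_distrr/=.
  have : (j * (n * Q).+1 <= j * \sum_i mu i)%N by rewrite leq_mul2l muQ orbT.
  apply: leq_trans.
  have : (n * p.-1 <= n * (j.+1 * Q))%N by rewrite leq_mul2l; lia.
  rewrite mulSn mulnDr mulnS mulnCA; lia.
have := dvdz_mcoeff_isolated pp vF (sep j p jQ (prime_gt0 pp)).
rewrite prod_lead// (dvdz_pcharf (pchar_Fp pp)) rmorph_prod/=.
apply/negP; apply/prodf_neq0 => i _; rewrite rmorphXn/= expf_neq0//.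
rewrite -(dvdz_pcharf (pchar_Fp pp)) /dvdz/=.
apply/negP => /dvdn_leq; rewrite absz_gt0 mleadc_eq0 f0 => /(_ isT).
have : (`|mcoeff (mlead (f i)) (f i)| <= \sum_i `|mcoeff (mlead (f i)) (f i)|)%N.
  by rewrite (bigD1 i)//= leq_addr.
move=> cS /leq_trans/(_ cS); rewrite leqNgt.
by rewrite (leq_ltn_trans _ pB)// leq_addl.
Qed.

(** * Laurent polynomials with prescribed leading exponents *)

Section leads.
Context (F : fieldType) (n N : nat) (x : 'I_N -> multinom n).
Hypothesis x_inj : injective x.

(** Exponents are natural numbers here: translating all exponents is
    multiplying by a monomial, which changes no vanishing order at 1. *)
Definition laurent (c : 'rV[F]_N) : mpoly n F :=
  \sum_i c 0 i *: @mpolyX n F (x i).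

Lemma mcoeff_laurent c i : mcoeff (x i) (laurent c) = c 0 i.
Proof.
rewrite /laurent raddf_sum/= (bigD1 i)//= mcoeffZ mcoeffX eqxx mulr1.
rewrite big1 ?addr0// => j ji; rewrite mcoeffZ mcoeffX (inj_eq x_inj).
by rewrite (negbTE ji) mulr0.
Qed.

Lemma msupp_laurent c m : m \in msupp (laurent c) -> exists i, m = x i.
Proof.
rewrite mcoeff_msupp => cm; apply: contrapT => xm; move/eqP: cm; apply.
rewrite /laurent raddf_sum/= big1// => i _; rewrite mcoeffZ mcoeffX.
have [xi|_] := eqVneq (x i) m; last by rewrite mulr0.
by exfalso; apply: xm; exists i.
Qed.

Lemma laurent_eq0 c : (laurent c == 0) = (c == 0).
Proof.
apply/eqP/eqP => [c0|->].
  by apply/rowP => i; rewrite -mcoeff_laurent c0 mcoeff0 mxE.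
by rewrite /laurent big1// => i _; rewrite mxE scale0r.
Qed.

Definition is_lead q (W : 'M[F]_(q, N)) (i : 'I_N) : bool :=
  `[< exists c : 'rV_N, [/\ (c <= W)%MS, c != 0 & mlead (laurent c) = x i] >].

(** A nonzero element of [W] has a nonzero coordinate at its leading exponent, so
    the projection of [W] to the coordinates that are leading is injective. *)
Lemma rank_le_lead q (W : 'M[F]_(q, N)) : (\rank W <= #|is_lead W|)%N.
Proof.
pose P : 'M[F]_(N, #|is_lead W|) := \matrix_(i, k) (i == enum_val k)%:R.
have <- : \rank (W *m P) = \rank W.
  rewrite -[RHS](mxrank_mul_ker W P) [X in (_ + X)%N](_ : _ = 0%N) ?addn0//.
  apply/eqP; rewrite mxrank_eq0; apply/rowV0P => v.
  rewrite sub_capmx => /andP[vW /sub_kermxP vP].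
  apply/eqP; apply: contraT => v0.
  have L0 : laurent v != 0 by rewrite laurent_eq0.
  have [i xi] := msupp_laurent (mlead_supp L0).
  have iW : is_lead W i by apply/asboolP; exists v.
  have : v 0 i != 0.
    by rewrite -mcoeff_laurent -xi mleadc_eq0.
  have := congr1 (fun M : 'rV_ _ => M 0 (enum_rank_in iW i)) vP.
  rewrite !mxE (bigD1 i)//= mxE enum_rankK_in// eqxx mulr1 big1 ?addr0.
    by move=> ->; rewrite eqxx.
  by move=> j ji; rewrite mxE enum_rankK_in// (negbTE ji) mulr0.
exact: rank_leq_col.
Qed.

End leads.

Lemma pairing_laurent (F : fieldType) n N (x : 'I_N -> multinom n)
    (c : 'rV[F]_N) g : pairing g (laurent x c) = \sum_i c 0 i * g (x i).
Proof.
rewrite /laurent (raddf_sum (pairing g))/=; apply: eq_bigr => i _.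
by rewrite (linearZ_LR (pairing g))/= pairingX.
Qed.

(** Integral coefficients are what makes reduction modulo a prime possible. *)
Lemma clear_denominators n (f : mpoly n rat) :
  exists (g : mpoly n int) (D : rat), D != 0 /\
    forall m, (mcoeff m g)%:~R = D * mcoeff m f.
Proof.
pose D : int := \prod_(m <- msupp f) denq (mcoeff m f).
have D0 : D != 0 by rewrite prodf_seq_neq0; apply/allP => m _; rewrite denq_neq0.
pose z m : int := numq (D%:Q * mcoeff m f).
exists (\sum_(m <- msupp f) z m *: @mpolyX n int m), D%:Q.
rewrite intr_eq0; split=> // m.
rewrite raddf_sum/=.
under eq_bigr do rewrite mcoeffZ mcoeffX.
have [mf|mf] := boolP (m \in msupp f); last first.
  rewrite (memN_msupp_eq0 mf) mulr0 big1_seq// => k /andP[_ kf].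
  by have [km|] := eqVneq k m; [rewrite -km kf in mf|rewrite mulr0].
rewrite (bigD1_seq m)//= ?msupp_uniq// eqxx mulr1 big1 ?addr0; last first.
  by move=> k /negbTE ->; rewrite mulr0.
rewrite /z numqK// /D (bigD1_seq m) ?msupp_uniq//= intrM mulrAC.
by rewrite (mulrC _ (mcoeff m f)) -numqE rpredM// intr_int.
Qed.

Lemma clear_denominators_spec n (f : mpoly n rat) (g : mpoly n int) (D : rat) :
  D != 0 -> (forall m, (mcoeff m g)%:~R = D * mcoeff m f) ->
  [/\ msupp g =i msupp f, mlead g = mlead f &
      forall r, vanishes1 r f -> vanishes1 r g].
Proof.
move=> D0 gf.
have gfE : msupp g =i msupp f.
  by move=> m; rewrite !mcoeff_msupp -(intr_eq0 rat) gf mulf_eq0 (negbTE D0).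
split=> //.
  rewrite /mlead; apply: perm_big; apply: uniq_perm; rewrite ?msupp_uniq//.
move=> r vf e /vf fe; apply/eqP; rewrite -(intr_eq0 rat).
suff -> : (pairing (mpow int e) g)%:~R = D * pairing (mpow rat e) f.
  by rewrite fe mulr0.
rewrite (@pairing_widen _ _ _ f (msupp g)) ?msupp_uniq//; last first.
  by move=> m; rewrite gfE.
rewrite /pairing rmorph_sum/= mulr_sumr; apply: eq_bigr => m _.
rewrite intrM gf mulrA; congr (_ * _).
by rewrite /mpow rmorph_prod; apply: eq_bigr => i _; rewrite rmorphXn /= rmorph_nat.
Qed.

(** Let [mu i] be the number of [l < D] such that [x i] is a leading exponent in
    the kernel of [E l]. Summed over [i], these numbers dominate the sum of the
    dimensions of the kernels, by [rank_le_lead]. *)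
Lemma vanishing_basis n N (x : 'I_N -> multinom n) (D : nat)
    (q : nat -> nat) (E : forall l, 'M[rat]_(N, q l)) : injective x ->
  (forall l c, c *m E l = 0 -> vanishes1 l.+1 (laurent x c)) ->
  exists (f : 'I_N -> mpoly n int) (mu : 'I_N -> nat),
    [/\ forall i, f i != 0, forall i, mlead (f i) = x i,
        forall i m, m \in msupp (f i) -> exists k, m = x k,
        forall i, vanishes1 (mu i) (f i) &
        (\sum_(l < D) (N - \rank (E l)) <= \sum_i mu i)%N].
Proof.
move=> x_inj EV.
pose isl l i := is_lead x (kermx (E l)) i.
pose mu i := (\sum_(l < D) isl l i)%N.
have key i : exists f : mpoly n int, [/\ f != 0, mlead f = x i,
    forall m, m \in msupp f -> exists k, m = x k & vanishes1 (mu i) f].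
  suff [f [f0 fx fs fv]] : exists f : mpoly n rat, [/\ f != 0, mlead f = x i,
      forall m, m \in msupp f -> exists k, m = x k & vanishes1 (mu i) f].
    have [g [d [d0 gE]]] := clear_denominators f.
    have [gs gl gv] := clear_denominators_spec d0 gE.
    exists g; split.
    - by rewrite -msupp_eq0 -size_eq0 (perm_size (uniq_perm _ _ gs)) ?msupp_uniq// size_eq0 msupp_eq0.
    - by rewrite gl.
    - by move=> m; rewrite gs; exact: fs.
    - exact: gv.
  (* Among [mu i] distinct indices [l], some is at least [mu i - 1]; an element
     of that kernel with leading exponent [x i] will do. *)
  have [[l lD li]|nol] := pselect (exists2 l, (mu i <= l.+1)%N & isl l i).
    move: li => /asboolP[c [/sub_kermxP cE c0 cx]].
    exists (laurent x c); split => //.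
    - by rewrite laurent_eq0.
    - exact: msupp_laurent.
    - exact: vanishes1_le (EV _ _ cE).
  (* Otherwise [mu i = 0], and a monomial is enough. *)
  exists (@mpolyX n rat (x i)); split => //.
  - by rewrite -msupp_eq0 msuppX.
  - by rewrite mleadXm.
  - by move=> m; rewrite msuppX inE => /eqP ->; exists i.
  - suff -> : mu i = 0%N by [].
    have H l : isl l i -> (l.+1 < mu i)%N.
      by move=> li; rewrite ltnNge; apply/negP => ml; apply: nol; exists l.
    have H' : (mu i <= \sum_(l < D) (l < (mu i).-1))%N.
      rewrite {1}/mu; apply: leq_sum => l _.
      case: (boolP (isl l i)) => // /H; case: (mu i) => //= k.
      by rewrite ltnS => ->.
    have B d k : (\sum_(l < d) (l < k) <= k)%N.
      suff : (\sum_(l < d) (l < k) <= minn d k)%N by lia.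
      elim: d => [|d IH]; first by rewrite big_ord0.
      by rewrite big_ord_recr/=; move: IH; case: (ltnP d k) => /=; lia.
    by have := leq_trans H' (B D (mu i).-1); case: (mu i) => //= k; rewrite ltnn.
have {key} [f fP] := choice key.
exists f, mu; split; try by move=> i; case: (fP i).
rewrite /mu exchange_big/=; apply: leq_sum => l _.
rewrite -mxrank_ker; apply: leq_trans (rank_le_lead x_inj _) _.
by rewrite -sum1_card big_mkcond /=; apply: leq_sum => i _; case: ifP => // li; rewrite [isl l i]li.
Qed.

(** * Ranks of evaluation matrices *)

Lemma card_bmultinom n l : #|{: bmultinom n l.+1}| = 'C(l + n, n).
Proof.
rewrite addnC -card_partial_ord_partitions.
pose f (m : bmultinom n l.+1) : n.-tuple 'I_l.+1 := [tuple inord (bmnm m i) | i < n].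
have mi (m : bmultinom n l.+1) i : (bmnm m i < l.+1)%N.
  apply: leq_ltn_trans (bmdeg m).
  by rewrite mdegE (bigD1 i)//= leq_addr.
have f_inj : injective f.
  move=> a b /(congr1 (fun t => fun i => val (tnth t i))) ab.
  apply/val_inj/mnmP => i; have := congr1 (fun g => g i) ab.
  by rewrite /= !tnth_mktuple !inordK.
rewrite -cardsT -(card_imset _ f_inj); apply: eq_card => t.
rewrite inE; apply/imsetP/idP => [[m _ ->]|tl].
  rewrite big_tuple; under eq_bigr do rewrite tnth_mktuple inordK//.
  by rewrite -mdegE -ltnS; exact: bmdeg.
have ml : (mdeg (Multinom [tuple (tnth t i : nat) | i < n]) < l.+1)%N.
  rewrite mdegE ltnS; move: tl; rewrite big_tuple.
  apply: leq_trans; apply: eq_leq; apply: eq_bigr => i _.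
  by rewrite multinomE tnth_mktuple.
exists (BMultinom ml) => //; apply: eq_from_tnth => i.
by apply: val_inj; rewrite tnth_mktuple /= multinomE tnth_mktuple inord_val.
Qed.

Section evaluation_matrix.
Context (F : numFieldType) (n N : nat) (y : 'I_N -> 'I_n -> int).

Definition evalmx l : 'M[F]_(N, #|{: bmultinom n l.+1}|) :=
  \matrix_(i, k) \prod_j (y i j)%:~R ^+ (bmnm (enum_val k) j).

Lemma sum_evalmx l (g : multinom n -> F) i :
  \sum_k g (bmnm (enum_val k)) * evalmx l i k =
  \sum_(m : bmultinom n l.+1) g (bmnm m) * \prod_j (y i j)%:~R ^+ (bmnm m j).
Proof.
rewrite [RHS](reindex (@enum_val _ {: bmultinom n l.+1}))/=; last first.
  exact: onW_bij (enum_val_bij _).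
by apply: eq_bigr => k _; rewrite mxE.
Qed.

Lemma sum_bmultinom l (p : mpoly n F) (g : multinom n -> F) :
  (msize p <= l.+1)%N ->
  \sum_(m : bmultinom n l.+1) mcoeff (bmnm m) p * g (bmnm m) = pairing g p.
Proof.
move=> pl.
rewrite (@pairing_widen _ _ g p [seq bmnm m | m <- index_enum (bmultinom n l.+1)]).
- by rewrite big_map.
- by rewrite (map_inj_uniq val_inj) /index_enum -enumT enum_uniq.
- move=> m mp; have ml : (mdeg m < l.+1)%N.
    by apply: leq_trans pl; exact: msize_mdeg_lt.
  by apply/mapP; exists (BMultinom ml) => //; exact: mem_index_enum.
Qed.

Lemma pairing_pow (z : 'I_n -> F) (p : mpoly n F) :
  pairing (fun m => \prod_j z j ^+ m j) p = meval z p.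
Proof. by rewrite mevalE. Qed.

(** The products of [p] with the monomials of degree at most [l - d] are
    independent and vanish at all the points: they are ['C(l - d + n, n)]
    independent relations between the columns. *)
Lemma rank_evalmx (p : mpoly n F) (d l : nat) : p != 0 -> (msize p <= d.+1)%N ->
  (forall i, meval (fun j => (y i j)%:~R) p = 0) -> (d <= l)%N ->
  (\rank (evalmx l) + 'C(l - d + n, n) <= 'C(l + n, n))%N.
Proof.
move=> p0 pd py dl.
pose K : 'M[F]_(#|{: bmultinom n (l - d).+1}|, #|{: bmultinom n l.+1}|) :=
  \matrix_(k, k') mcoeff (bmnm (enum_val k')) (p * @mpolyX n F (bmnm (enum_val k))).
have sK (k : bmultinom n (l - d).+1) :
    (msize (p * @mpolyX n F (bmnm k)) <= l.+1)%N.
  have X0 : @mpolyX n F (bmnm k) != 0 by rewrite -msupp_eq0 msuppX.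
  rewrite msizeM// msizeX addnS/=.
  by have := bmdeg k; move: pd dl; move: (msize p) (mdeg _); lia.
have rK : \rank K = #|{: bmultinom n (l - d).+1}|.
  apply/eqP; rewrite -/(row_free K) -kermx_eq0; apply/rowV0P => v.
  move/sub_kermxP => vK.
  pose q : mpoly n F := \sum_k v 0 k *: @mpolyX n F (bmnm (enum_val k)).
  have qk k : mcoeff (bmnm (enum_val k)) q = v 0 k.
    rewrite /q raddf_sum/= (bigD1 k)//= mcoeffZ mcoeffX eqxx mulr1 big1 ?addr0//.
    move=> j jk; rewrite mcoeffZ mcoeffX (inj_eq val_inj) (inj_eq enum_val_inj).
    by rewrite (negbTE jk) mulr0.
  suff q0 : q = 0 by apply/rowP => k; rewrite -qk q0 mcoeff0 mxE.
  suff /eqP : p * q = 0 by rewrite mulf_eq0 (negbTE p0) => /eqP.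
  have pqE : p * q = \sum_k v 0 k *: (p * @mpolyX n F (bmnm (enum_val k))).
    by rewrite /q mulr_sumr; apply: eq_bigr => k _; rewrite -scalerAr.
  apply/mpolyP => m; rewrite mcoeff0.
  have [ml|lm] := ltnP (mdeg m) l.+1.
    have := congr1 (fun M : 'rV_ _ => M 0 (enum_rank (BMultinom ml))) vK.
    rewrite !mxE => <-; rewrite pqE raddf_sum/=; apply: eq_bigr => k _.
    by rewrite mcoeffZ mxE enum_rankK.
  rewrite pqE raddf_sum/= big1// => k _; rewrite mcoeffZ memN_msupp_eq0 ?mulr0//.
  by apply: msize_mdeg_ge; exact: leq_trans lm.
have EK : evalmx l *m K^T = 0.
  apply/matrixP => i k; rewrite !mxE.
  under eq_bigr do rewrite mulrC [K^T _ _]mxE [K _ _]mxE.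
  rewrite (sum_evalmx _ (fun m : multinom n => mcoeff m (p * @mpolyX n F (bmnm (enum_val k))))).
  rewrite /= (@sum_bmultinom l _ (fun m => \prod_j (y i j)%:~R ^+ m j) (sK _)).
  rewrite pairing_pow.
  by rewrite mevalM py mul0r.
have := mulmx0_rank_max EK.
by rewrite mxrank_tr rK -(card_bmultinom n l) -(card_bmultinom n (l - d)).
Qed.

Lemma evalmx_meval l (c : 'rV[F]_N) (p : mpoly n F) :
  c *m evalmx l = 0 -> (msize p <= l.+1)%N ->
  \sum_i c 0 i * meval (fun j => (y i j)%:~R) p = 0.
Proof.
move=> cE pl.
have pE i : meval (fun j => (y i j)%:~R) p =
    \sum_k mcoeff (bmnm (enum_val k)) p * evalmx l i k.
  rewrite -pairing_pow -(sum_bmultinom _ pl).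
  by rewrite (sum_evalmx l (fun m => mcoeff m p)).
under eq_bigr do rewrite pE mulr_sumr.
rewrite exchange_big/= big1// => k _.
transitivity (mcoeff (bmnm (enum_val k)) p * (c *m evalmx l) 0 k).
  by rewrite mxE mulr_sumr; apply: eq_bigr => i _; rewrite mulrCA.
by rewrite cE mxE mulr0.
Qed.

End evaluation_matrix.

(** The vanishing polynomial is real, but the Laurent polynomials have to be
    rational. *)
Lemma rank_evalmx_rat (F : numFieldType) n N (y : 'I_N -> 'I_n -> int) l :
  \rank (evalmx rat y l) = \rank (evalmx F y l).
Proof.
rewrite -(mxrank_map (@ratr F)); congr mxrank; apply/matrixP => i k.
rewrite !mxE rmorph_prod; apply: eq_bigr => j _.
by rewrite rmorphXn /= ratr_int.
Qed.

(** The moments of the translated exponents [x i = y i + v] are polynomials of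
    the same degree in the points [y i]. *)
Lemma evalmx_vanishes n N (y : 'I_N -> 'I_n -> int) (x : 'I_N -> multinom n) (v : int) l c :
  (forall i j, (x i j)%:Z = y i j + v) ->
  c *m evalmx rat y l = 0 -> vanishes1 l.+1 (laurent x c).
Proof.
move=> xy cE e el; rewrite pairing_laurent.
pose P : mpoly n rat := \prod_j (@mpolyX n rat (mnm1 j) + mpolyC n v%:~R) ^+ e j.
have Pe : (msize P <= l.+1)%N.
  apply: leq_trans el; rewrite mdegE; apply: msize_prod_le => j.
  rewrite -[X in (_ <= X.+1)%N]muln1; apply: msizeX_le.
  apply: (leq_trans (mmeasureD_le _ _ _)).
  by rewrite msizeX mdeg1 geq_max mmeasureC; case: (_ == 0).
rewrite -[RHS](evalmx_meval cE Pe); apply: eq_bigr => i _; congr (_ * _).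
rewrite /mpow /P rmorph_prod; apply: eq_bigr => j _.
by rewrite rmorphXn/= mevalD mevalXU mevalC -intrD -xy -pmulrn.
Qed.

(** * The inequality for finitely many lattice points *)

Lemma hockey_stick n D : (\sum_(l < D) 'C(l + n, n) = 'C(D + n, n.+1))%N.
Proof.
elim: D => [|D IH]; first by rewrite big_ord0 bin_small.
by rewrite big_ord_recr/= IH addSn binS addnC.
Qed.

Lemma hockey_stick_shift n d D : (d <= D)%N ->
  (\sum_(l < D) (if d <= l then 'C(l - d + n, n) else 0) = 'C(D - d + n, n.+1))%N.
Proof.
move=> dD; rewrite -(subnK dD) addnC; move: (D - d)%N => e.
rewrite big_split_ord/= big1 ?add0n; last by move=> i _; rewrite leqNgt ltn_ord.
rewrite addKn -hockey_stick; apply: eq_bigr => i _.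
by rewrite leq_addr addKn.
Qed.

Lemma nat_of_shift (n N : nat) (y : 'I_N -> 'I_n -> int) :
  exists (v : int) (x : 'I_N -> multinom n), forall i j, (x i j)%:Z = y i j + v.
Proof.
pose v : nat := (\sum_i \sum_j absz (y i j))%N.
exists v%:Z, (fun i => Multinom [tuple absz (y i j + v%:Z) | j < n]) => i j.
rewrite multinomE tnth_mktuple gez0_abs//.
have : (absz (y i j) <= v)%N.
  rewrite /v (bigD1 i)//= (bigD1 j)//=.
  by rewrite -addnA leq_addr.
lia.
Qed.

(** Combines the upper bound [n Q] for the sum of the vanishing orders with the
    lower bound [sum_l (N - h_l)], in which each rank [h_l] is estimated through
    the multiples of [p]. The set [C] plays the part of the interior of [K]; the
    points, recentred at their mean and scaled by [N], have to lie in [Q C]. *)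
Lemma evaluation_inequality (R : realType) (n N : nat) (y : 'I_N -> 'I_n -> int)
    (C : set 'rV[R]_n) (Q D d : nat) (p : mpoly n R) :
  injective y -> (0 < N)%N -> (0 < Q)%N ->
  C 0 ->
  (forall a b t, C a -> C b -> 0 <= t -> t <= 1 -> C (t *: a + (1 - t) *: b)) ->
  (forall z : 'I_n -> int, C (\row_j (z j)%:~R) -> forall j, z j = 0) ->
  (forall i, exists2 u, C u &
     forall j, (N%:Z * y i j - \sum_k y k j)%:~R = Q%:R * u 0 j :> R) ->
  p != 0 -> (msize p <= d.+1)%N -> (d <= D)%N ->
  (forall i, meval (fun j => (y i j)%:~R) p = 0) ->
  (D * N + 'C(D - d + n, n.+1) <= n * Q + 'C(D + n, n.+1))%N.
Proof.
move=> y_inj N0 Q0 C0 Cconv Cint Csep p0 pd dD py.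
have [v [x xy]] := nat_of_shift y.
have x_inj : injective x.
  move=> i k ik; apply: y_inj; apply/funext => j.
  by apply: (addIr v); rewrite -!xy ik.
pose r l := \rank (evalmx rat y l).
have [f [mu [f0 fx fs fv mur]]] :=
  vanishing_basis D x_inj (fun l c => @evalmx_vanishes n N y x v l c xy).
have sumr : (\sum_(l < D) r l + 'C(D - d + n, n.+1) <= 'C(D + n, n.+1))%N.
  rewrite -hockey_stick_shift// -hockey_stick -big_split/=; apply: leq_sum => l _.
  case: ifPn => dl; rewrite /r (rank_evalmx_rat R).
    exact: rank_evalmx p0 pd py dl.
  by rewrite addn0 -card_bmultinom; exact: rank_leq_col.
have sumN : (D * N <= \sum_(l < D) (N - r l) + \sum_(l < D) r l)%N.
  rewrite -big_split/= -[X in (X * _)%N]card_ord -sum_nat_const.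
  by apply: leq_sum => l _; lia.
suff muQ : (\sum_i mu i <= n * Q)%N.
  have := leq_trans mur muQ; rewrite -/(r _) => H.
  have := leq_add (leq_trans sumN (leq_add H (leqnn _))) (leqnn 'C(D - d + n, n.+1)).
  by move/leq_trans; apply; rewrite -addnA leq_add2l.
apply: (@sum_vanishing_le _ _ f mu) => // j q jQ q0 F m mF mt.
(* [N (x i) - sum_k x k] does not depend on the translation from [y] to [x],
   and by convexity membership in multiples of [Q C] is additive. *)
pose cond a (m : multinom n) := exists2 u, C u & forall i,
  N%:R * (m i)%:R - a%:R * \sum_k (x k i)%:R = a%:R * Q%:R * u 0 i :> R.
have : cond (N * j)%N m.
  have -> : (N * j = size (index_enum 'I_N) * j)%N.
    by rewrite /index_enum -enumT size_enum_ord.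
  apply: msupp_prod_ind mF => [|a b m1 m2 [u1 Cu1 E1] [u2 Cu2 E2]|i k].
  - by exists 0 => // i; rewrite mnm0E mulr0 !mul0r subrr.
  - have [ab|ab] := eqVneq (a + b)%N 0%N.
      move: ab E1 E2 => /eqP; rewrite addn_eq0 => /andP[/eqP -> /eqP ->] E1 E2.
      exists 0 => // i; have := E1 i; have := E2 i.
      by rewrite mnmDE !natrD mxE; lra.
    have ab0 : (a + b)%:R != 0 :> R by rewrite pnatr_eq0.
    exists ((a%:R / (a + b)%:R) *: u1 + (1 - a%:R / (a + b)%:R) *: u2).
      apply: Cconv => //.
      by rewrite ler_pdivrMr ?mul1r ?ler_nat ?leq_addr// ltr0n lt0n.
    move=> i; rewrite mnmDE !mxE.
    have -> : (a + b)%:R * Q%:R * (a%:R / (a + b)%:R * u1 0 i +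
        (1 - a%:R / (a + b)%:R) * u2 0 i) =
        a%:R * Q%:R * u1 0 i + b%:R * Q%:R * u2 0 i :> R.
      have bE : (b%:R : R) = (a + b)%:R - a%:R by rewrite natrD; ring.
      by rewrite bE; field; rewrite -natrD.
    by rewrite -E1 -E2 !natrD; ring.
  - move=> /fs[l ->]; have [u Cu E] := Csep l; exists u => // jj.
    rewrite !mul1r -E.
    have xR a b : (x a b)%:R = (y a b)%:~R + v%:~R :> R.
      by rewrite -intrD -xy -pmulrn.
    under eq_bigr do rewrite xR.
    rewrite big_split/= sumr_const card_ord xR rmorphB rmorphM rmorph_sum/=.
    rewrite /= -mulr_natl -pmulrn; ring.
move=> [u Cu E].
have tE i : (mlead F i = \sum_k j * x k i)%N.
  rewrite /F mlead_prod; last by move=> k _ _; rewrite expf_neq0.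
  rewrite mnm_sumE; apply: eq_bigr => k _.
  by rewrite mleadX// fx mulmnE mulnC.
have mtE i : (m i)%:R - (mlead F i)%:R = j%:R * Q%:R * u 0 i :> R.
  have NR : (N%:R : R) != 0 by rewrite pnatr_eq0 -lt0n.
  apply: (mulfI NR); rewrite mulrBr tE natr_sum.
  under [X in _ - _ * X]eq_bigr do rewrite natrM.
  rewrite -mulr_sumr; have := E i; rewrite natrM => {}E.
  by rewrite mulrA E; ring.
(* A congruence [m = j s] modulo [q] makes [z = (m - j s) / q] a lattice point of
   [C], because [j Q <= q]. *)
pose z i : int := (((m i)%:Z - (mlead F i)%:Z) %/ q%:Z)%Z.
have zE i : (m i)%:Z - (mlead F i)%:Z = z i * q%:Z.
  rewrite /z divzK// -eqz_mod_dvd; apply/eqP.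
  by rewrite !modz_nat mt.
have qR : 0 < q%:R :> R by rewrite ltr0n.
have zR i : (z i)%:~R = (j%:R * Q%:R / q%:R) * u 0 i :> R.
  apply: (mulIf (lt0r_neq0 qR)).
  have -> : j%:R * Q%:R / q%:R * u 0 i * q%:R = j%:R * Q%:R * u 0 i.
    by field; rewrite lt0r_neq0.
  rewrite -mtE; have := congr1 (fun a : int => a%:~R : R) (zE i).
  by rewrite rmorphB rmorphM /= -!pmulrn => <-.
have z0 : forall i, z i = 0.
  apply: Cint.
  have -> : \row_i (z i)%:~R = (j%:R * Q%:R / q%:R) *: u +
      (1 - (j%:R * Q%:R / q%:R)) *: 0 :> 'rV[R]_n.
    by apply/rowP => i; rewrite !mxE zR mulr0 addr0.
  apply: Cconv => //.
  by rewrite ler_pdivrMr// mul1r -natrM ler_nat.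
apply/mnmP => i; have := zE i; rewrite z0 mul0r => /eqP.
by rewrite subr_eq0 => /eqP[].
Qed.

(** * Lebesgue measure and the grid of mesh 1/(k+1) *)

Section grid.
Context (R : realType) (n : nat).
Implicit Types (x y : 'rV[R]_n) (A : set 'rV[R]_n).

Lemma nbhs_rV x A : nbhs x A <->
  exists2 e : R, 0 < e & forall y, (forall i, `|x 0 i - y 0 i| < e) -> A y.
Proof.
split=> [/nbhs_ballP[e /= e0 eA]|[e e0 eA]].
  exists e => // y xy; apply: eA; split=> // i j.
  by rewrite (ord1 i); exact: xy.
apply/nbhs_ballP; exists e => //= y [_ xy].
by apply: eA => i; exact: xy.
Qed.

Definition cell k (a : {ffun 'I_n -> int}) : set 'rV[R]_n :=
  [set y | forall i, [set` `[(a i)%:~R / k.+1%:R, (a i + 1)%:~R / k.+1%:R[] (y 0 i)].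

Definition corner k y : {ffun 'I_n -> int} :=
  [ffun i => Num.floor (k.+1%:R * y 0 i)].

Definition node k (a : {ffun 'I_n -> int}) : 'rV[R]_n :=
  \row_i ((a i)%:~R / k.+1%:R).

Lemma cellP k a y : cell k a y <-> corner k y = a.
Proof.
have k0 : 0 < k.+1%:R :> R by rewrite ltr0n.
have E i : [set` `[(a i)%:~R / k.+1%:R, (a i + 1)%:~R / k.+1%:R[] (y 0 i) <->
    Num.floor (k.+1%:R * y 0 i) = a i.
  rewrite /= in_itv/= ler_pdivrMr// ltr_pdivlMr// mulrC.
  split=> [|<-]; first exact: floor_def.
  by rewrite floor_itv.
split=> [ya|ya i]; first by apply/ffunP => i; rewrite ffunE; exact/E/ya.
by apply/E; rewrite -ya ffunE.
Qed.

Lemma dist_corner k y i : `|node k (corner k y) 0 i - y 0 i| <= k.+1%:R^-1.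
Proof.
have k0 : 0 < k.+1%:R :> R by rewrite ltr0n.
have := (cellP k (corner k y) y).2 erefl i.
rewrite /= in_itv/= mxE intrD mulrDl mul1r => /andP[y1 y2].
have ki : 0 < k.+1%:R^-1 :> R by rewrite invr_gt0.
rewrite distrC ler_norml; move: y1 y2 ki.
move: (k.+1%:R^-1) (_%:~R) => c z y1 y2 ki; apply/andP; split; lra.
Qed.

Lemma measurable_rV_box (A : 'I_n -> set (measurableTypeR R)) :
  (forall i, measurable (A i)) ->
  measurable [set x : 'rV[R]_n | forall i, A i (x 0 i)].
Proof.
move=> mA; rewrite (_ : [set _ | _] = \bigcap_(i in [set: 'I_n])
    ((fun x : 'rV[R]_n => x 0 i : measurableTypeR R) @^-1` A i)).
  apply: fin_bigcap_measurable => // i _.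
  by rewrite -[X in measurable X]setTI; exact: measurable_coord.
by apply/seteqP; split => x /= Ax i; [move=> _|]; exact: Ax.
Qed.

Lemma measurable_cell k a : measurable (cell k a).
Proof.
by apply: (measurable_rV_box (A := fun i => [set` `[(a i)%:~R / k.+1%:R,
  (a i + 1)%:~R / k.+1%:R[])) => i; exact: measurable_itv.
Qed.

Lemma lebesgue_cell k a : lebesgue_rV R n (cell k a) = (k.+1%:R ^- n)%:E.
Proof.
rewrite (lebesgue_rV_box (A := fun i => [set` `[(a i)%:~R / k.+1%:R,
  (a i + 1)%:~R / k.+1%:R[])); last by move=> i; exact: measurable_itv.
have k0 : 0 < k.+1%:R :> R by rewrite ltr0n.
rewrite (eq_bigr (fun=> (k.+1%:R^-1)%:E)); last first.
  move=> i _; rewrite lebesgue_measure_itv/= lte_fin ltr_pM2r ?invr_gt0//.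
  rewrite ltr_int ltrDl ltr01 -EFinB; congr EFin.
  by rewrite intrD mulrDl mul1r addrAC subrr add0r.
rewrite -exprVn; elim: (n) => [|m IH]; first by rewrite big_ord0 expr0.
by rewrite big_ord_recl IH exprS EFinM.
Qed.

(** An open set is the union of the grid cells that it contains, and there are
    countably many cells. *)
Lemma open_measurable_rV A : open A -> measurable A.
Proof.
move=> oA.
have -> : A = \bigcup_(p : nat * {ffun 'I_n -> int})
    (if `[< cell p.1 p.2 `<=` A >] then cell p.1 p.2 else set0).
  apply/seteqP; split=> [x Ax|x [[k a] _]]; last first.
    by case: ifPn => // /asboolP; apply.
  have /nbhs_rV[e e0 eA] : nbhs x A by apply: open_nbhs_nbhs.
  have [k ke] : exists k : nat, 2 / k.+1%:R < e.
    have [k _ /(_ k (leqnn k)) /= ke] :=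
      near_infty_natSinv_lt (PosNum (divr_gt0 e0 (ltr0n R 2))).
    by exists k; move: ke; rewrite ltr_pdivlMr// mulrC.
  exists (k, corner k x) => //=; case: ifPn => [_|/asboolPn []].
    exact/cellP.
  move=> y /cellP yx; apply: eA => i; apply: le_lt_trans ke.
  rewrite -(subrKA (node k (corner k x) 0 i)).
  rewrite (le_trans (ler_normD _ _))// mulr_natl mulr2n lerD//.
    by rewrite distrC dist_corner.
  by rewrite -yx dist_corner.
apply: countable_bigcupT_measurable; first exact: countableP.
move=> [k a]; case: ifP => _ //; exact: measurable_cell.
Qed.

Lemma closed_measurable_rV A : closed A -> measurable A.
Proof.
by move=> cA; rewrite -(setCK A); apply: measurableC; apply: open_measurable_rV; rewrite openC.
Qed.

End grid.

(** * Scaling of Lebesgue measure *)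

Section scaling.
Context (R : realType).

Lemma lebesgue_measure_scale (c : R) (A : set (measurableTypeR R)) : 0 < c ->
  measurable A ->
  lebesgue_measure A = (c%:E * lebesgue_measure (( *%R c : _ -> measurableTypeR R) @^-1` A))%E.
Proof.
move=> c0 mA.
have mc : measurable_fun setT ( *%R c : measurableTypeR R -> measurableTypeR R).
  exact: mulrl_measurable.
pose m := mscale (NngNum (ltW c0)) (pushforward (@lebesgue_measure R) ( *%R c : measurableTypeR R -> measurableTypeR R)).
transitivity (m mc A) => //.
apply: lebesgue_measure_unique => // _ [[a b] _ <-]/=.
change (lebesgue_measure [set` `]a, b]] = c%:E * lebesgue_measure
  (( *%R c : measurableTypeR R -> measurableTypeR R) @^-1` [set` `]a, b]]))%E.
have -> : ( *%R c : measurableTypeR R -> measurableTypeR R) @^-1` [set` `]a, b]] =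
    [set` `]a / c, b / c]].
  apply/seteqP; split=> x /=; rewrite !in_itv/= ltr_pdivrMr// ler_pdivlMr//; by rewrite (mulrC x).
rewrite !lebesgue_measure_itv/= !lte_fin ltr_pM2r ?invr_gt0//.
case: ifPn => _; last by rewrite mule0.
rewrite -!EFinB -EFinM; congr EFin. field. exact: lt0r_neq0.
Qed.

(** Both sides are measures in [A], and they agree on boxes by the
    one-dimensional case. *)
Lemma lebesgue_rV_scale n (c : R) (A : set 'rV[R]_n) : 0 < c ->
  measurable A ->
  lebesgue_rV R n A =
  ((c ^+ n)%:E * lebesgue_rV R n (( *:%R c : 'rV[R]_n -> 'rV[R]_n) @^-1` A))%E.
Proof.
move=> c0 mA.
have mc : measurable_fun setT ( *:%R c : 'rV[R]_n -> 'rV[R]_n).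
  apply: measurable_fun_rV => i; under eq_fun do rewrite mxE.
  by apply: measurableT_comp (measurable_coord i); exact: mulrl_measurable.
pose m := mscale (NngNum (exprn_ge0 n (ltW c0)))
  (pushforward (lebesgue_rV R n) ( *:%R c : 'rV[R]_n -> 'rV[R]_n)).
pose box (B : 'I_n -> set (measurableTypeR R)) := [set x : 'rV[R]_n | forall i, B i (x 0 i)].
have mbox B : (forall i, measurable (B i)) -> measurable (box B).
  exact: measurable_rV_box.
pose G := [set box B | B in [set B | forall i, measurable (B i)]].
pose I k : set (measurableTypeR R) := [set` `[- k%:R, k%:R]].
transitivity (m mc A) => //.
apply: (measure_unique G (fun k => box (fun=> I k))) => //.
- apply/seteqP; split.
  + apply: smallest_sub; first exact: smallest_sigma_algebra.
    rewrite -bigcup_seq => _ [i _] [B mB <-] /=.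
    apply: sub_sigma_algebra; exists (fun j => if j == i then B else setT).
      by move=> j /=; case: ifP.
    rewrite setTI; apply/seteqP; split=> x /=.
      by move/(_ i); rewrite eqxx.
    by move=> Bx j; case: eqP => [->|].
  + apply: smallest_sub; first exact: sigma_algebra_measurable.
    by move=> _ [B mB <-]; exact: mbox.
- move=> _ _ [B mB <-] [B' mB' <-]; exists (fun i => B i `&` B' i).
    by move=> i; apply: measurableI; [exact: mB|exact: mB'].
  by apply/seteqP; split=> x /=; [move=> H; split=> i; case: (H i)|move=> [H H'] i; split].
- by move=> k; exists (fun=> I k) => //= i; exact: measurable_itv.
- apply/seteqP; split => // x _.
  pose t (i : 'I_n) := (Num.truncn `|x 0 i|).+1.
  exists (\max_(i < n) t i)%N => // i.
  rewrite /I /= in_itv/= -ler_norml.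
  apply: (le_trans (ltW (truncnS_gt _))); rewrite ler_nat.
  exact: (leq_bigmax (F := t)).
- move=> _ [B mB <-].
  change (lebesgue_rV R n (box B) = (c ^+ n)%:E * lebesgue_rV R n
    (( *:%R c : 'rV[R]_n -> 'rV[R]_n) @^-1` (box B)))%E.
  rewrite lebesgue_rV_box//.
  have -> : ( *:%R c : 'rV[R]_n -> 'rV[R]_n) @^-1` (box B) =
      box (fun i => ( *%R c : _ -> measurableTypeR R) @^-1` B i).
    by apply/seteqP; split=> x /= Bx i; have := Bx i; rewrite mxE.
  rewrite lebesgue_rV_box; last first.
    by move=> i; rewrite -[X in measurable X]setTI; apply: mulrl_measurable => //; exact: mB.
  under eq_bigr do rewrite (lebesgue_measure_scale c0)//.
  rewrite big_split/=; congr (_ * _)%E.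
  by rewrite -(big_morph EFin (@EFinM R) erefl) prodr_const card_ord.
- move=> k; change (lebesgue_rV R n (box (fun=> I k)) < +oo)%E.
  rewrite lebesgue_rV_box; last by move=> i; exact: measurable_itv.
  have E : lebesgue_measure (I k) = (k%:R + k%:R)%:E.
    rewrite /I lebesgue_measure_itv/= lte_fin; case: ltP => [_|].
      by rewrite -EFinB opprK.
    have : 0 <= k%:R :> R by [].
    by move=> k0 kk; congr EFin; lra.
  by under eq_bigr do rewrite E; rewrite -(big_morph EFin (@EFinM R) erefl) ltry.
Qed.
End scaling.

(** * Convex bodies have negligible boundary *)

Section convex_facts.
Context (R : realType) (n : nat) (K : set 'rV[R]_n).
Hypothesis cK : convex_set K.

Lemma convex_setP x y t : K x -> K y -> 0 <= t -> t <= 1 ->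
  K (t *: x + (1 - t) *: y).
Proof.
move=> Kx Ky t0 t1.
have := @cK x y (Itv01 t0 t1); rewrite !inE => /(_ Kx Ky).
by rewrite /conv /=.
Qed.

Lemma interior_convex x y t : K° x -> K° y -> 0 <= t -> t <= 1 ->
  K° (t *: x + (1 - t) *: y).
Proof.
move=> /nbhs_rV[e e0 eK] /nbhs_rV[e' e'0 e'K] t0 t1.
apply/nbhs_rV; exists (Num.min e e'); first by rewrite lt_min e0.
move=> z zxy; pose w := z - (t *: x + (1 - t) *: y).
have -> : z = t *: (x + w) + (1 - t) *: (y + w).
  by apply/rowP => i; rewrite !mxE; ring.
have wE (u : 'rV[R]_n) i : `|u 0 i - (u + w) 0 i| < Num.min e e'.
  have -> : u 0 i - (u + w) 0 i = (t *: x + (1 - t) *: y) 0 i - z 0 i.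
    by rewrite /w !mxE; ring.
  exact: zxy.
apply: convex_setP => //.
  by apply: eK => i; have := wE x i; rewrite lt_min => /andP[].
by apply: e'K => i; have := wE y i; rewrite lt_min => /andP[].
Qed.

Hypothesis K0 : K° 0.

(** A ball of radius [e] around 0 in [K] yields one of radius [(1 - t) e] around
    [t *: x]. *)
Lemma shrink_interior x t : K x -> 0 <= t -> t < 1 -> K° (t *: x).
Proof.
move=> Kx t0 t1; have := K0 => /nbhs_rV[e e0 eK].
have t1' : 0 < 1 - t by rewrite subr_gt0.
apply/nbhs_rV; exists ((1 - t) * e); first by rewrite mulr_gt0.
move=> z zx; pose w := (1 - t)^-1 *: (z - t *: x).
have -> : z = t *: x + (1 - t) *: w.
  by rewrite /w scalerA divff ?lt0r_neq0// scale1r addrC subrK.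
apply: convex_setP => //; last exact: ltW.
apply: eK => i; have := zx i; rewrite !mxE sub0r normrN distrC => h.
by rewrite normrM gtr0_norm ?invr_gt0// ltr_pdivrMl.
Qed.

Lemma bernoulli_ineq (d : R) m : 0 <= d -> d <= 1 -> 1 - m%:R * d <= (1 - d) ^+ m.
Proof.
move=> d0 d1; elim: m => [|m IH]; first by rewrite mul0r subr0 expr0.
rewrite exprS -natr1 mulrDl mul1r.
have : (1 - d) * (1 - m%:R * d) <= (1 - d) * (1 - d) ^+ m.
  by rewrite ler_wpM2l// subr_ge0.
apply: le_trans.
have : 0 <= m%:R * d * d by rewrite !mulr_ge0.
by move=> h; rewrite mulrBl mul1r mulrBr mulr1; lra.
Qed.

(** [(1 - d) K] lies in the interior of [K] if [0 < d < 1], and its volume is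
    [(1 - d)^n] times that of [K]; let [d] tend to 0. *)
Lemma interior_full_measure (V : R) : closed K -> lebesgue_rV R n K = V%:E ->
  lebesgue_rV R n K° = V%:E.
Proof.
move=> clK KV.
have mK : measurable K by exact: closed_measurable_rV.
have mKi : measurable K° by apply: open_measurable_rV; exact: open_interior.
have le1 : (lebesgue_rV R n K° <= V%:E)%E.
  by rewrite -KV le_measure ?inE//; exact: interior_subset.
have KiW : lebesgue_rV R n K° = (fine (lebesgue_rV R n K°))%:E.
  by rewrite fineK// ge0_fin_numE ?measure_ge0// (le_lt_trans le1)// ltry.
move: le1; rewrite KiW; set W := fine _; rewrite lee_fin => WV.
congr EFin; apply/eqP; rewrite eq_le WV/=.
have V0 : 0 <= V by rewrite -lee_fin -KV measure_ge0.
have key d : 0 < d -> d < 1 -> (1 - n%:R * d) * V <= W.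
  move=> d0 d1; have d1' : 0 < 1 - d by rewrite subr_gt0.
  apply: (@le_trans _ _ ((1 - d) ^+ n * V)).
    by rewrite ler_wpM2r// bernoulli_ineq// ltW.
  rewrite -lee_fin EFinM -KV -KiW (lebesgue_rV_scale d1' mKi).
  apply: lee_wpmul2l; first by rewrite lee_fin exprn_ge0// ltW.
  have mP : measurable (( *:%R (1 - d) : 'rV[R]_n -> 'rV[R]_n) @^-1` K°).
    have mc : measurable_fun setT ( *:%R (1 - d) : 'rV[R]_n -> 'rV[R]_n).
      apply: measurable_fun_rV => i; under eq_fun do rewrite mxE.
      by apply: measurableT_comp (measurable_coord i); exact: mulrl_measurable.
    by rewrite -[X in measurable X]setTI; exact: mc.
  apply: (le_measure _ (mem_set mK) (mem_set mP)).
  by move=> x Kx /=; apply: shrink_interior => //; lra.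
rewrite leNgt; apply/negP => WV'.
pose d := Num.min 2^-1 ((V - W) / (2 * (n%:R * V + 1))).
have nV : 0 < n%:R * V + 1 by rewrite ltr_wpDl ?mulr_ge0.
have d0 : 0 < d.
  by rewrite lt_min; apply/andP; split; rewrite ?invr_gt0 ?divr_gt0 ?subr_gt0 ?mulr_gt0.
have d1 : d < 1 by rewrite gt_min; apply/orP; left; lra.
have := key d d0 d1; apply/negP; rewrite -ltNge.
have : d * (2 * (n%:R * V + 1)) <= V - W.
  by rewrite -ler_pdivlMr ?mulr_gt0// ge_min lexx orbT.
have : 0 <= d * (n%:R * V) by rewrite !mulr_ge0// ltW.
have -> : (1 - n%:R * d) * V = V - d * (n%:R * V) by ring.
have -> : d * (2 * (n%:R * V + 1)) = 2 * (d * (n%:R * V)) + 2 * d by ring.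
by move: (d * (n%:R * V)) => c; lra.
Qed.

End convex_facts.

(** * Riemann sums over the lattice points of a convex body *)

Section riemann_sums.
Context (R : realType) (n : nat) (K : set 'rV[R]_n) (B : nat).
Hypothesis KB : forall x, K x -> forall i, `|x 0 i| <= B%:R.

(** The integral vectors [a] such that [a / (k+1)] is interior to [K]. The bound
    [B] on the coordinates of [K] is there to enumerate them. *)
Definition nodes k : seq {ffun 'I_n -> int} :=
  [seq a <- [seq [ffun i => (t i : nat)%:Z - (B * k.+1)%:Z] |
              t : {ffun 'I_n -> 'I_(2 * (B * k.+1)).+1}] |
    `[< K° (node R k a) >]].

Lemma nodes_uniq k : uniq (nodes k).
Proof.
rewrite filter_uniq// map_inj_uniq ?enum_uniq// => s t /ffunP st.
apply/ffunP => i; apply/val_inj/eqP; have := st i; rewrite !ffunE.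
by move/addIr => [st_i]; apply/eqP.
Qed.

Lemma mem_nodes k a : (a \in nodes k) = `[< K° (node R k a) >].
Proof.
rewrite mem_filter; case: asboolP => //= Ka.
have aB i : (absz (a i) <= B * k.+1)%N.
  have := KB (interior_subset Ka) i; rewrite mxE normrM normfV normr_nat.
  rewrite ler_pdivrMr ?ltr0n// -natrM -intr_norm -abszE.
  by rewrite -pmulrn ler_nat.
apply/mapP; exists [ffun i => inord (absz (a i + (B * k.+1)%:Z))].
  by rewrite mem_enum.
apply/ffunP => i; rewrite !ffunE inordK; have := aB i; lia.
Qed.

Lemma cvg_corner (y : 'rV[R]_n) (A : set 'rV[R]_n) : nbhs y A ->
  \forall k \near \oo, A (node R k (corner k y)).
Proof.
move=> /nbhs_rV[e e0 eA].
near=> k; apply: eA => i; rewrite distrC.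
apply: le_lt_trans (dist_corner k y i) _.
by near: k; exact: (near_infty_natSinv_lt (PosNum e0)).
Unshelve. all: by end_near. Qed.

Context (phi : 'rV[R]_n -> R) (C : R).
Hypothesis phi_cont : continuous phi.
Hypothesis phi_mf : measurable_fun setT phi.
Hypothesis phiC : forall x, K x -> `|phi x| <= C.
Hypothesis clK : closed K.
Hypothesis K0 : K° 0.
Hypothesis cK : convex_set K.
Variable V : R.
Hypothesis KV : lebesgue_rV R n K = V%:E.

(* The step function equal to [phi] at the corner of the cell containing [y], or to
   0 when that corner is not interior to [K]. *)
Let G k (y : 'rV[R]_n) : \bar R :=
  (\sum_(a <- nodes k) (phi (node R k a))%:E * (\1_(cell k a) y)%:E)%E.

Let GE k y : G k y = if `[< K° (node R k (corner k y)) >]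
  then (phi (node R k (corner k y)))%:E else 0%E.
Proof.
have cE a : \1_(cell k a) y = (a == corner k y)%:R :> R.
  rewrite indicE; congr (nat_of_bool _)%:R; apply/idP/eqP.
    by rewrite inE => /cellP.
  by move=> ->; rewrite inE; exact/cellP.
rewrite /G; case: ifPn => [|nK].
  rewrite -mem_nodes => yn.
  rewrite (bigD1_seq (corner k y)) ?nodes_uniq//= cE eqxx mule1.
  by rewrite big1 ?adde0// => a /negbTE ay; rewrite cE ay mule0.
rewrite big1_seq// => a /andP[_]; rewrite mem_nodes => aK.
rewrite cE; case: eqP => [ay|]; last by rewrite mule0.
by rewrite -ay aK in nK.
Qed.

Let cell_integrable k a :
  (lebesgue_rV R n).-integrable setT (fun y => (\1_(cell k a) y)%:E).
Proof.
apply/integrableP; split.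
  by apply/measurable_EFinP; apply: measurable_indic; exact: measurable_cell.
under eq_integral do rewrite gee0_abs ?lee_fin//.
rewrite integral_indic ?setIT//; last exact: measurable_cell.
by rewrite [X in (X < _)%E]lebesgue_cell ltry.
Qed.

Let G_integral k : (\int[lebesgue_rV R n]_y G k y)%E =
  ((\sum_(a <- nodes k) phi (node R k a)) / k.+1%:R ^+ n)%:E.
Proof.
rewrite /G integral_sum//; last first.
  by move=> a; apply: (integrableZl measurableT); exact: cell_integrable.
rewrite mulr_suml -sumEFin; apply: eq_bigr => a _.
rewrite (integralZl measurableT (cell_integrable k a)).
rewrite integral_indic ?setIT//; last exact: measurable_cell.
by rewrite [X in (_ * X)%E]lebesgue_cell EFinM.
Qed.

(** The sum is the integral of a step function, and these step functions converge
    to [phi] in the interior of [K] and to 0 outside [K]. *)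
Lemma riemann_sum_cvg :
  (\sum_(a <- nodes k) phi (node R k a)) / k.+1%:R ^+ n @[k --> \oo] -->
  \int[lebesgue_rV R n]_(y in K) phi y.
Proof.
have C0 : 0 <= C by apply: le_trans (phiC (interior_subset K0)).
have mK : measurable K by exact: closed_measurable_rV.
have mKi : measurable K° by apply: open_measurable_rV; exact: open_interior.
pose box := [set y : 'rV[R]_n | forall i, [set` `[- (B%:R + 1), B%:R + 1]] (y 0 i)].
have mbox : measurable box.
  by apply: (measurable_rV_box (A := fun=> [set` `[- (B%:R + 1), B%:R + 1]])) => i; exact: measurable_itv.
pose f := (fun y : 'rV[R]_n => (phi y)%:E) \_ K.
have [] := @dominated_convergence _ _ _ (lebesgue_rV R n) setT measurableT G f
   (fun y => C%:E * (\1_box y)%:E)%E.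
- move=> k; apply: (measurable_int (lebesgue_rV R n)).
  apply: integrable_sum => // a _; apply: (integrableZl measurableT); exact: cell_integrable.
- apply: (measurable_restrictT _ mK).1; apply: measurable_funTS.
  exact/measurable_EFinP.
- exists (K `\` K°); split.
  + exact: measurableD.
  + rewrite measureD//; last by rewrite [X in (X < _)%E]KV ltry.
    rewrite setIidr; last exact: interior_subset.
    rewrite [X in (X - _)%E]KV.
    by rewrite [X in (_ - X)%E](interior_full_measure cK K0 clK KV) subee.
  + move=> y /= ny; apply: contrapT => yK; apply: ny => _.
    have [yi|yi] := pselect (K° y).
      rewrite /f patchE mem_set; last exact: interior_subset.
      have : G k y @[k --> \oo] --> (phi y)%:E; last by [].
      have : (phi (node R k (corner k y)))%:E @[k --> \oo] --> (phi y)%:E.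
        apply: cvg_EFin; first exact: nearW.
        move=> A nA; apply: (@cvg_corner y (phi @^-1` A)).
        exact: phi_cont.
      apply: cvg_trans; apply: near_eq_cvg.
      have := cvg_corner (nbhs_interior yi); apply: filterS => k Kk.
      by rewrite GE asboolT.
    have {}yK : ~ K y by move=> Ky; apply: yK.
    rewrite /f patchE memNset//.
    apply: cvg_near_cst.
    have : nbhs y (~` K) by apply: open_nbhs_nbhs; split=> //; exact: closed_openC.
    move=> /cvg_corner; apply: filterS => k nK.
    by rewrite GE asboolF// => /interior_subset.
- apply: integrableZl => //; apply/integrableP; split.
    by apply/measurable_EFinP; exact: measurable_indic.
  under eq_integral do rewrite gee0_abs ?lee_fin//.
  rewrite integral_indic ?setIT//.
  rewrite [X in (X < _)%E](lebesgue_rV_box (A := fun=> [set` `[- (B%:R + 1), B%:R + 1]])); last first.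
    by move=> i; exact: measurable_itv.
  under eq_bigr do rewrite lebesgue_measure_itv/= lte_fin.
  have -> : - (B%:R + 1) < B%:R + 1 :> R.
    by have : 0 <= B%:R :> R by []; lra.
  by under eq_bigr do rewrite -EFinB; rewrite -(big_morph EFin (@EFinM R) erefl) ltry.
- apply: aeW => y k _; rewrite GE; case: asboolP => [Kk|_]; last first.
    by rewrite abse0 mule_ge0 ?lee_fin.
  rewrite indicE mem_set; last first.
    move=> i; rewrite /= in_itv/= -ler_norml.
    rewrite -(subrK (node R k (corner k y) 0 i) (y 0 i)) addrC.
    apply: le_trans (ler_normD _ _) _; apply: lerD.
      exact: KB (interior_subset Kk) i.
    rewrite distrC; apply: le_trans (dist_corner k y i) _.
    by rewrite invf_le1 ?ler1n ?ltr0n.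
  by rewrite /= mule1 lee_fin; exact: phiC (interior_subset Kk).
move=> fi _; rewrite /= -integral_mkcond => GI.
have fin : (\int[lebesgue_rV R n]_(y in K) (phi y)%:E)%E \is a fin_num.
  by apply: integrable_fin_num => //; apply/(integrable_mkcond _ mK).
rewrite /Rintegral.
have -> : (fun k => (\sum_(a <- nodes k) phi (node R k a)) / k.+1%:R ^+ n) =
    fine \o (fun k => \int[lebesgue_rV R n]_x G k x)%E.
  by apply/funext => k /=; rewrite G_integral.
by apply: fine_cvg; rewrite fineK.
Qed.

End riemann_sums.

(** * The asymptotic comparison *)

Lemma expn_le_bin x m : (x ^ m.+1 <= 'C(x + m, m.+1) * m.+1`!)%N.
Proof.
rewrite bin_ffact ffact_prod -[X in (x ^ X)%N]card_ord -prod_nat_const.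
by apply: leq_prod => i _; have := ltn_ord i; lia.
Qed.

Lemma bin_le_expn x m : ('C(x + m, m.+1) * m.+1`! <= (x + m) ^ m.+1)%N.
Proof.
rewrite bin_ffact ffact_prod -[X in (_ ^ X)%N]card_ord -prod_nat_const.
by apply: leq_prod => i _; exact: leq_subr.
Qed.

Section body.
Context (R : realType) (n : nat) (K : set 'rV[R]_n).

Lemma compact_coord_bounded : compact K ->
  exists B : nat, forall x, K x -> forall i, `|x 0 i| <= B%:R.
Proof.
move=> /compact_bounded[M [_ MK]].
exists (Num.truncn (`|M| + 1)).+1 => x Kx i.
have := MK (`|M| + 1); rewrite (le_lt_trans (ler_norm M)) ?ltrDl// => /(_ isT x Kx) xM.
apply: le_trans (ltW (truncnS_gt _)); apply: le_trans xM.
rewrite /Num.norm/= mx_normrE.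
exact: (le_bigmax 0 (fun ij => `|x ij.1 ij.2|) (ord0, i)).
Qed.

Lemma node_dilate_points k (a : {ffun 'I_n -> int}) : K° (node R k a) ->
  dilate_points K k.+1 (\row_i (a i)%:~R).
Proof.
move=> /nbhs_rV[e e0 eK]; split.
  by move=> i; rewrite mxE intr_int.
have k0 : 0 < k.+1%:R :> R by rewrite ltr0n.
apply/nbhs_rV; exists (k.+1%:R * e); first by rewrite mulr_gt0.
move=> y ay; exists (k.+1%:R^-1 *: y); last first.
  by rewrite scalerA divff ?lt0r_neq0// scale1r.
apply: eK => i; rewrite !mxE mulrC -mulrBr normrM gtr0_norm ?invr_gt0//.
by rewrite ltr_pdivrMl//; have := ay i; rewrite mxE.
Qed.

Lemma msize_total_degree (p : mpoly n R) : (msize p <= (total_degree p).+1)%N.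
Proof.
rewrite msizeE; apply/bigmax_leqP_seq => m mp _; rewrite ltnS /total_degree.
by apply: leq_bigmax_seq.
Qed.

Hypothesis cK : convex_set K.
Hypothesis K0 : K° 0.
Hypothesis Kint : forall z : 'I_n -> int, K° (\row_j (z j)%:~R) -> forall j, z j = 0.
Variable B : nat.
Hypothesis KB : forall x, K x -> forall i, `|x 0 i| <= B%:R.

(** [evaluation_inequality] for the lattice points interior to [(k+1) K], with
    [Q] just above [(1 + eta) N (k+1)]. The bound on the sum of the nodes puts
    their mean [u] into [- eta K], so that a node minus [u] is
    [1 + eta] times a convex combination of two interior points of [K]: the node
    itself and [- u / eta]. *)
Lemma lattice_inequality (e eta : R) (k : nat) (p : mpoly n R) (D : nat) :
  (forall y : 'rV[R]_n, (forall i, `|y 0 i| < e) -> K° y) -> 0 < eta ->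
  (0 < size (nodes K B k))%N ->
  (forall i, `|\sum_(a <- nodes K B k) node R k a 0 i| < (size (nodes K B k))%:R * (eta * e)) ->
  p != 0 -> vanishes_on p (dilate_points K k.+1) -> (total_degree p <= D)%N ->
  (D%:R * (size (nodes K B k))%:R * (n.+1`!)%:R + (D%:R - (total_degree p)%:R) ^+ n.+1 <=
   n%:R * ((1 + eta) * ((size (nodes K B k))%:R * k.+1%:R) + 1) * (n.+1`!)%:R +
   (D%:R + n%:R) ^+ n.+1 :> R).
Proof.
set s := nodes K B k; set N := size s => eK eta0 N0 ucond p0 pv pD.
pose y (i : 'I_N) : 'I_n -> int := nth [ffun => 0] s i.
have k0 : 0 < k.+1%:R :> R by rewrite ltr0n.
have NR0 : 0 < N%:R :> R by rewrite ltr0n.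
have y_inj : injective y.
  move=> i j ij; apply/val_inj/eqP.
  rewrite -(nth_uniq [ffun => 0] (ltn_ord i) (ltn_ord j) (nodes_uniq K B k)).
  by apply/eqP/ffunP => l; have := congr1 (fun g => g l) ij.
have yK (i : 'I_N) : K° (node R k (nth [ffun => 0] s i)).
  by apply/asboolP; rewrite -(mem_nodes KB) mem_nth.
pose t := (1 + eta) * (N%:R * k.+1%:R) : R.
have t0 : 0 < t by rewrite mulr_gt0 ?mulr_gt0//; lra.
pose Q := (Num.truncn t).+1.
have Q0 : 0 < Q%:R :> R by rewrite ltr0n.
have tQ : t <= Q%:R by rewrite ltW// truncnS_gt.
have Qt : Q%:R <= t + 1.
  by rewrite -natr1 lerD2r; have /andP[] := truncn_itv (ltW t0).
pose u : 'rV[R]_n := N%:R^-1 *: \sum_(a <- s) node R k a.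
have := @evaluation_inequality R n N y K° Q D (total_degree p) p y_inj N0 isT K0
  (interior_convex cK) Kint.
move=> H.
have {}H : (D * N + 'C(D - total_degree p + n, n.+1) <= n * Q + 'C(D + n, n.+1))%N.
  apply: H => //; last 2 first.
  - exact: msize_total_degree.
  - move=> i; have := pv _ (node_dilate_points (yK i)).
    by move=> <-; apply: meval_eq => j; rewrite mxE.
  move=> i.
  have uE j : u 0 j = N%:R^-1 * \sum_(a <- s) node R k a 0 j.
    by rewrite mxE summxE.
  have Ku : K° (- eta^-1 *: u).
    apply: eK => j; rewrite mxE uE mulNr normrN !normrM !normfV normr_nat (gtr0_norm eta0).
    by rewrite ltr_pdivrMl// ltr_pdivrMl//; exact: ucond.
  have l0 : 0 <= (1 + eta)^-1 by rewrite invr_ge0; lra.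
  have l1 : (1 + eta)^-1 <= 1 by rewrite invf_le1; lra.
  have Kw := interior_convex cK (yK i) Ku l0 l1.
  have q0 : 0 <= t / Q%:R by rewrite divr_ge0// ltW.
  have q1 : t / Q%:R <= 1 by rewrite ler_pdivrMr// mul1r.
  exists ((t / Q%:R) *: ((1 + eta)^-1 *: node R k (nth [ffun => 0] s i) +
           (1 - (1 + eta)^-1) *: (- eta^-1 *: u)) + (1 - t / Q%:R) *: 0).
    exact: (interior_convex cK Kw K0 q0 q1).
  move=> j; rewrite !mxE summxE.
  have -> : \sum_(a <- s) node R k a 0 j = (\sum_k y k j)%:~R / k.+1%:R.
    rewrite rmorph_sum mulr_suml (big_nth [ffun => 0]) big_mkord.
    by apply: eq_bigr => l _; rewrite mxE.
  rewrite rmorphB rmorphM/= -pmulrn -/(y i j) mulr0 addr0 /t.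
  move: (_%:~R) (_%:~R) => a b; field.
  have eta1 : 0 < 1 + eta by lra.
  by rewrite nat1r !lt0r_neq0.
move: H; rewrite -(leq_pmul2r (fact_gt0 n.+1)) !mulnDl => H.
have {H} : (D * N * n.+1`! + (D - total_degree p) ^ n.+1 <=
    n * Q * n.+1`! + (D + n) ^ n.+1)%N.
  apply: leq_trans (leq_trans _ H) _.
    by rewrite leq_add2l expn_le_bin.
  by rewrite leq_add2l bin_le_expn.
move: (n.+1`!)%N => F.
rewrite -(ler_nat R) !natrD !natrM !natrX natrB// natrD => /le_trans; apply.
rewrite lerD2r ler_wpM2r// ler_wpM2l//.
Qed.

End body.

(** The inequality of [lattice_inequality], divided by [m^(n+1)] after [d] has
    been replaced by its upper bound. *)
Lemma normalized_inequality (R : realFieldType) n (N F d eps eta m : R) :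
  1 <= m -> 0 <= F -> 0 <= eps ->
  d <= (n.+1%:R - eps) * m ->
  (n.+1%:R * m) * N * F + (n.+1%:R * m - d) ^+ n.+1 <=
    n%:R * ((1 + eta) * (N * m) + 1) * F + (n.+1%:R * m + n%:R) ^+ n.+1 ->
  F * (N / m ^+ n) * (1 - n%:R * eta) + eps ^+ n.+1 - F * n%:R * m^-1 <=
    (n.+1%:R + n%:R * m^-1) ^+ n.+1.
Proof.
move=> m1 F0 e0 dm H.
have m0 : 0 < m by apply: lt_le_trans m1.
have M0 : 0 < m ^+ n.+1 by rewrite exprn_gt0.
rewrite -(ler_pM2r M0) -exprMn.
have -> : (n.+1%:R + n%:R * m^-1) * m = n.+1%:R * m + n%:R.
  by field; rewrite lt0r_neq0.
have h1 : (eps * m) ^+ n.+1 <= (n.+1%:R * m - d) ^+ n.+1.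
  have em : 0 <= eps * m by rewrite mulr_ge0 // ltW.
  by move: dm; rewrite mulrBl => dm; apply: lerXn2r; rewrite ?nnegrE; lra.
have h2 : n%:R * F <= n%:R * F * m ^+ n.
  by rewrite ler_peMr ?mulr_ge0// exprn_ege1.
have -> : (F * (N / m ^+ n) * (1 - n%:R * eta) + eps ^+ n.+1 - F * n%:R * m^-1) * m ^+ n.+1
  = F * N * m * (1 - n%:R * eta) + (eps * m) ^+ n.+1 - n%:R * F * m ^+ n.
  rewrite exprMn (exprS m n); field.
  by rewrite expf_neq0 lt0r_neq0.
move: h1 h2 H; move: ((n.+1%:R * m - d) ^+ n.+1) ((eps * m) ^+ n.+1) (m ^+ n).
move=> P E M h1 h2; move: ((_ + _) ^+ n.+1) => T; rewrite -natr1; lra.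
Qed.

Section main.
Context (R : realType) (n : nat) (K : set 'rV[R]_n).
Hypothesis hK : convex_body K.
Hypothesis hbary : barycenter K = 0.
Hypothesis hint : K° `&` integer_points R n = [set 0].
Hypothesis hvol : lebesgue_rV R n K = (n.+1%:R ^+ n / n`!%:R)%:E.

Lemma no_low_degree (eps : R) : 0 < eps ->
  \forall k \near \oo, forall p : mpoly n R, p != 0 ->
    (total_degree p)%:R <= (n.+1%:R - eps) * k.+1%:R ->
    ~ vanishes_on p (dilate_points K k.+1).
Proof.
move=> eps0; have [cptK cK _] := hK.
have K0 : K° 0 by have : [set (0 : 'rV[R]_n)] 0 by []; rewrite -hint => -[].
have clK : closed K by apply: compact_closed => //; exact: norm_hausdorff.
have Kint (z : 'I_n -> int) : K° (\row_j (z j)%:~R) -> forall j, z j = 0.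
  move=> Kz j; have : (K° `&` integer_points R n) (\row_j (z j)%:~R).
    by split=> // i; rewrite mxE intr_int.
  rewrite hint => /rowP/(_ j); rewrite !mxE => /eqP.
  by rewrite intr_eq0 => /eqP.
have [B KB] := compact_coord_bounded cptK.
pose V : R := n.+1%:R ^+ n / n`!%:R.
have V0 : 0 < V by rewrite divr_gt0 ?exprn_gt0// ltr0n ?fact_gt0.
pose N k : R := (size (nodes K B k))%:R.
pose a k : R := N k / k.+1%:R ^+ n.
have aV : a k @[k --> \oo] --> V.
  have := @riemann_sum_cvg R n K B KB (fun=> 1) 1 (@cst_continuous _ _ _)
    (measurable_cst _) _ clK K0 cK V hvol.
  have -> : \int[lebesgue_rV R n]_(x in K) 1 = V.
    rewrite /Rintegral integral_cst ?mul1e ?[X in fine X]hvol//.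
    exact: closed_measurable_rV.
  have -> : (fun k => (\sum_(a <- nodes K B k) 1) / k.+1%:R ^+ n) = a.
    by apply/funext => k; rewrite /a /N -sum1_size natr_sum.
  by apply=> x _; rewrite normr1.
have b0 i : (\sum_(a <- nodes K B k) node R k a 0 i) / k.+1%:R ^+ n @[k --> \oo] --> 0.
  have := @riemann_sum_cvg R n K B KB (fun x => x 0 i) B%:R (@coord_continuous _ _ _ 0 i)
    (measurable_coord i) (fun x Kx => KB x Kx i) clK K0 cK V hvol.
  suff -> : \int[lebesgue_rV R n]_(x in K) x 0 i = 0 by [].
  have := congr1 (fun M : 'rV[R]_n => M 0 i) hbary; rewrite !mxE hvol /= => /eqP.
  by rewrite mulf_eq0 invr_eq0 (gt_eqF V0) => /eqP.
have /nbhs_rV[e e0 eK] := nbhs_interior K0.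
have {}eK (y : 'rV[R]_n) : (forall i, `|y 0 i| < e) -> K° y.
  by move=> ye; apply: eK => i; rewrite mxE sub0r normrN.
pose F : R := n.+1`!%:R.
have F0 : 0 < F by rewrite ltr0n fact_gt0.
have FV : F * V = n.+1%:R ^+ n.+1.
  rewrite /F /V factS natrM exprS; field.
  by rewrite lt0r_neq0 ?ltr0n ?fact_gt0.
(* In the limit the inequality reads [F V (1 - n eta) + eps^(n+1) <= F V], which
   fails for this [eta]. *)
pose eta : R := eps ^+ n.+1 / (2 * (n%:R * (F * V) + 1)).
have nFV : 0 <= n%:R * (F * V) by rewrite !mulr_ge0 // ltW.
have eta0 : 0 < eta by rewrite divr_gt0 ?exprn_gt0 ?mulr_gt0 ?ltr_wpDl.
have etaE : n%:R * (F * V) * eta < eps ^+ n.+1.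
  rewrite /eta mulrA ltr_pdivrMr ?mulr_gt0 ?ltr_wpDl//.
  have : 0 < eps ^+ n.+1 by rewrite exprn_gt0.
  by move: nFV (eps ^+ _) => + x x0; move: (n%:R * _) => c c0; nra.
have N0 : \forall k \near \oo, 0 < a k by exact: (cvgr_gt V aV).
have ub : \forall k \near \oo, forall i : 'I_n,
    `|(\sum_(a <- nodes K B k) node R k a 0 i) / k.+1%:R ^+ n| < a k * (eta * e).
  apply: filter_forall => i.
  have c : (a k * (eta * e) - `|(\sum_(a <- nodes K B k) node R k a 0 i) / k.+1%:R ^+ n|)
      @[k --> \oo] --> V * (eta * e) - `|0 : R|.
    by apply: cvgB; [apply: cvgMl|exact: cvg_norm].
  have := cvgr_gt _ c 0; rewrite normr0 subr0 => /(_ _ (mulr_gt0 V0 (mulr_gt0 eta0 e0))).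
  by apply: filterS => k; rewrite subr_gt0.
have fin : \forall k \near \oo, 0 < F * a k * (1 - n%:R * eta) + eps ^+ n.+1 -
    F * n%:R * k.+1%:R^-1 - (n.+1%:R + n%:R * k.+1%:R^-1) ^+ n.+1.
  have h : (k.+1%:R^-1 : R) @[k --> \oo] --> 0 by exact: cvg_harmonic.
  apply: (cvgr_gt (F * V * (1 - n%:R * eta) + eps ^+ n.+1 - F * n%:R * 0 - (n.+1%:R + n%:R * 0) ^+ n.+1)).
    apply: cvgB; [apply: cvgB; [apply: cvgD|]|].
    - by apply: cvgMl; apply: cvgMr.
    - exact: cvg_cst.
    - exact: cvgMr.
    - apply: (@cvg_comp _ _ _ _ (fun x : R => x ^+ n.+1)); last exact: exprn_continuous.
      by apply: cvgD; [exact: cvg_cst|apply: cvgMr].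
  rewrite !mulr0 subr0 addr0 -FV; move: etaE; lra.
near=> k => p p0 pd pv.
have M0 : 0 < k.+1%:R ^+ n :> R by rewrite exprn_gt0 ?ltr0n.
have s0 : (0 < size (nodes K B k))%N.
  rewrite -(ltr0n R); have : 0 < a k by near: k.
  by rewrite /a pmulr_lgt0 ?invr_gt0.
have uc : forall i : 'I_n, `|\sum_(a <- nodes K B k) node R k a 0 i| < N k * (eta * e).
  move=> i.
  have : forall i : 'I_n, `|(\sum_(a <- nodes K B k) node R k a 0 i) / k.+1%:R ^+ n| < a k * (eta * e).
    by near: k.
  move=> /(_ i); rewrite normrM normfV (gtr0_norm M0) /a mulrAC ltr_pM2r ?invr_gt0//.
have dD : (total_degree p <= n.+1 * k.+1)%N.
  rewrite -(ler_nat R) natrM; apply: le_trans pd _.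
  by rewrite ler_wpM2r// gerBl ltW.
have := lattice_inequality cK K0 Kint KB eK eta0 s0 uc p0 pv dD.
rewrite natrM -/(N k) -/F => H.
have m1 : 1 <= k.+1%:R :> R by rewrite ler1n.
have := normalized_inequality m1 (ltW F0) (ltW eps0) pd H.
rewrite -/(a k) -subr_le0; apply/negP; rewrite -ltNge.
by near: k.
Unshelve. all: by end_near. Qed.

End main.

Theorem theorem4p2 (R : realType) (n : nat) (K : set 'rV[R]_n)
    (hK : convex_body K)
    (hbary : barycenter K = 0)
    (hint : K° `&` integer_points R n = [set 0])
    (hvol : lebesgue_rV R n K = (n.+1%:R ^+ n / n`!%:R)%:E) :
  (forall eps : R, 0 < eps ->
     \forall k \near \oo, forall p : mpoly n R, p != 0 ->
       (total_degree p)%:R <= (n.+1%:R - eps) * k%:R ->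
       ~ vanishes_on p (dilate_points K k)) /\
  (n.+1%:R%:E <=
     limn_einf (fun k : nat => delta (dilate_points K k) * (k%:R^-1)%:E))%E.
Proof.
have low (eps : R) : 0 < eps -> \forall k \near \oo, forall p : mpoly n R, p != 0 ->
    (total_degree p)%:R <= (n.+1%:R - eps) * k%:R ->
    ~ vanishes_on p (dilate_points K k).
  move=> eps0; have [M _ HM] := no_low_degree hK hbary hint hvol eps0.
  by exists M.+1 => // -[//|k] /= Mk; exact: HM.
split=> //; rewrite limn_einf_lim; apply/lee_subgt0Pr => eps eps0.
rewrite -EFinB; apply: lime_ge; first exact: is_cvg_einfs.
have [M _ HM] := low eps eps0.
exists M.+1 => // m /= Mm; rewrite /einfs /sdrop /=.
apply: le_ereal_inf_tmp => _ [k /= mk <-].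
have k0 : 0 < k%:R :> R by rewrite ltr0n; lia.
have -> : (n.+1%:R - eps)%:E = (((n.+1%:R - eps) * k%:R)%:E * (k%:R^-1)%:E)%E.
  by rewrite -EFinM mulfK// lt0r_neq0.
apply: lee_wpmul2r; first by rewrite lee_fin invr_ge0 ltW.
apply: le_ereal_inf_tmp => _ [p [p0 pv] <-]; rewrite lee_fin leNgt.
apply/negP => /ltW pk; apply: (HM k _ p p0 pk pv).
by rewrite /=; lia.
Qed.
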